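(* Let $K\subset S^3$ be an oriented link. For a complexity-minimizing diagram $D\in\mathcal{D}(K)$ and $i\ge 3$ let $\beta_i(D)$ be the coefficient of $q^{h_i(D)+i-3}$ in $J_K^i(q)$, and let $J_D^+(q)=\sum_{i=3}^{\infty}\beta_i(D) q^i$. Then the power series $J_D^+(q)$ is independent of the choice of $D\in\mathcal{D}(K)$ (that is, $J_D^+(q)=J_{D'}^+(q)$ for all $D,D'\in\mathcal{D}(K)$), and thus it is an invariant of $K$.
   Context: Diagrams. $D$ is a link diagram in the plane $\mathbb{R}^2$, $c(D)$ is its number of crossings, $c_-(D)$ its number of negative crossings and $\omega(D)$ its writhe. The $+$-resolution of a crossing is the smoothing that receives the coefficient $A$ in the Kauffman bracket skein relation (crossing) $= A\,(\text{$+$-resolution}) + A^{-1}\,(\text{$-$-resolution})$ (standard convention: the $+$-resolution joins the two regions swept out when the over-strand is rotated counterclockwise). $|s_+(D)|$ is the number of disjoint circles (state circles) obtained by applying the $+$-resolution at every crossing of $D$. $\mathcal{D}(K)$ is the set of diagrams of $K$ that minimize, among all diagrams of $K$, the complexity $(c_-(D),\,c(D),\,|s_+(D)|-\omega(D))$ ordered lexicographically. For $n\ge2$, $$h_n(D) = -\tfrac14\left((n-1)^2c(D)+2(n-1)|s_+(D)|\right)+\tfrac{(n-1)^2+2(n-1)}{4}\,\omega(D).$$ Skein theory. The linear skein $\mathcal{S}(F)$ of a surface $F$ (with possibly finitely many marked boundary points) is the space of formal linear combinations of isotopy classes of link diagrams in $F$ modulo the Kauffman skein relation above and $D\sqcup\bigcirc=(-A^2-A^{-2})D$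 for a trivial circle; $A$ is treated as an indeterminate and coefficients may be rational functions of $A$. For an element of $\mathcal{S}(\mathbb{R}^2)$, $\langle\cdot\rangle$ denotes the coefficient of the empty diagram after reduction by these relations. $TL_n$ is the skein of the disc with $n$ marked points on top and $n$ on the bottom, an algebra under stacking, with identity $|_n$ ($n$ parallel strands) and generators $e_n^1,\dots,e_n^{n-1}$ (where $e_n^i$ has a cap and a cup joining the adjacent points $i,i+1$ on the top and on the bottom, and straight strands elsewhere). The Jones-Wenzl projector $f_n\in TL_n$ is the unique element with: $f_n e_n^i=e_n^i f_n=0$ for $1\le i\le n-1$; $f_n-|_n$ lies in the (non-unital) algebra generated by $e_n^1,\dots,e_n^{n-1}$; $f_nf_n=f_n$; and the planar closure of $f_n$ equals $\triangle_n=\frac{(-1)^n(A^{2(n+1)}-A^{-2(n+1)})}{A^2-A^{-2}}$ times the empty diagram. Colored Jones polynomial. For a diagram $D$ of $K$, let $D^m_{f}$ be the skein in $\mathcal{S}(\mathbb{R}^2)$ obtained by replacing each component of $D$ by $m$ parallel copies along the blackboard framing and inserting one copy of $f_m$ in each cabled component. For $n\ge2$, $$J_K^n(q)=\left((-1)^{n-1}q^{\frac{(n-1)^2+2(n-1)}{4}}\right)^{\omega(D)}\left\langle D^{n-1}_{f}\right\rangle\Big|_{A^{-1}=q^{1/4}}.$$ It does not depend on the choice of the diagram $D$ of $K$, and for the unknot it equals $\triangle_{n-1}|_{A^{-1}=q^{1/4}}$. *)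

(* Defs.v *)
From HB Require Import structures.
From Stdlib Require Import Relation_Operators.
From mathcomp Require Import all_boot all_order all_algebra.
From mathcomp Require Import boolp classical_sets.

Set Implicit Arguments.
Unset Strict Implicit.
Unset Printing Implicit Defensive.

Import Order.TTheory GRing.Theory Num.Theory.
Local Open Scope ring_scope.

(* Diagrams in Morse position.  A diagram is a word of elementary pieces
   stacked from bottom to top, read from left to right in the word.  The
   strands met by a horizontal line are numbered from 0, from left to right;
   the letter (k, i) places the piece k on the strands i, i + 1 (for a cup: it
   creates strands i, i + 1).
   - Cup is a local minimum, Cap a local maximum;
   - Cross true is the crossing whose over-strand is "/" (it goes from bottom
     left to top right), Cross false the one whose over-strand is "\". *)
Inductive piece := Cup | Cap | Cross of bool.

Definition piece_code (p : piece) : option (option bool) :=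
  match p with Cup => None | Cap => Some None | Cross b => Some (Some b) end.
Definition piece_decode (o : option (option bool)) : piece :=
  match o with None => Cup | Some None => Cap | Some (Some b) => Cross b end.
Lemma piece_codeK : cancel piece_code piece_decode.
Proof. by case. Qed.
HB.instance Definition _ := Choice.copy piece (can_type piece_codeK).

Definition letter : Type := (piece * nat)%type.
Definition word : Type := seq letter.

Definition arity_in (p : piece) : nat := if p is Cup then 0 else 2.
Definition arity_out (p : piece) : nat := if p is Cap then 0 else 2.

Fixpoint target (w : word) (a : nat) : option nat :=
  if w is (p, i) :: w' then
    if (i + arity_in p <= a)%N
    then target w' (a - arity_in p + arity_out p)%N else None
  else Some a.

(* w is a diagram in a disc with a marked points at the bottom and b at the
   top; for a = b = 0, a diagram in the plane. *)
Definition tangle (a b : nat) (w : word) : Prop := target w a = Some b.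

Definition shift (k : nat) (w : word) : word :=
  [seq (l.1, (l.2 + k)%N) | l <- w].

(* Generators of planar isotopy for words: exchange of the heights of two
   distant pieces, creation or cancellation of a minimum-maximum pair, and
   passage of a local extremum of one strand through a crossing. *)
Inductive planar_move : word -> word -> Prop :=
| PM_exchange p q i k :
    planar_move [:: (p, i); (q, (i + arity_out p + k)%N)]
                [:: (q, (i + arity_in p + k)%N); (p, i)]
| PM_zigzag_left i : planar_move [:: (Cup, i); (Cap, i.+1)] [::]
| PM_zigzag_right i : planar_move [:: (Cup, i.+1); (Cap, i)] [::]
| PM_cup_cross b i :
    planar_move [:: (Cup, i); (Cross b, i.+1)]
                [:: (Cup, i.+1); (Cross (~~ b), i)]
| PM_cross_cap b i :
    planar_move [:: (Cross b, i); (Cap, i.+1)]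
                [:: (Cross (~~ b), i.+1); (Cap, i)].

(* In the third move, the side condition excludes the two cyclic
   configurations, where none of the strands is above the two others. *)
Inductive reidemeister_move : word -> word -> Prop :=
| RM1_right b i :
    reidemeister_move [:: (Cup, i.+1); (Cross b, i); (Cap, i.+1)] [::]
| RM1_left b i :
    reidemeister_move [:: (Cup, i); (Cross b, i.+1); (Cap, i)] [::]
| RM2 b i : reidemeister_move [:: (Cross b, i); (Cross (~~ b), i)] [::]
| RM3 b b' b'' i : (b = b'' -> b' = b) ->
    reidemeister_move
      [:: (Cross b, i); (Cross b', i.+1); (Cross b'', i)]
      [:: (Cross b'', i.+1); (Cross b', i); (Cross b, i.+1)].

(* Components.  The strands at a given height carry labels, two strands having
   the same label iff they are connected below that height. *)
Definition fresh (l : seq nat) : nat := (foldr maxn 0 l).+1.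

Definition label_step (x : letter) (l : seq nat) : seq nat :=
  let i := x.2 in
  match x.1 with
  | Cup => take i l ++ [:: fresh l; fresh l] ++ drop i l
  | Cap => [seq if z == nth 0 l i.+1 then nth 0 l i else z
           | z <- take i l ++ drop i.+2 l]
  | Cross _ => take i l ++ [:: nth 0 l i.+1; nth 0 l i] ++ drop i.+2 l
  end.

(* The piece x is the maximum at which a component gets closed; each component
   of a closed diagram has exactly one. *)
Definition closes (x : letter) (l : seq nat) : bool :=
  if x.1 is Cap then nth 0 l x.2 == nth 0 l x.2.+1 else false.

Fixpoint ncomp_from (l : seq nat) (w : word) : nat :=
  if w is x :: w' then (closes x l + ncomp_from (label_step x l) w')%N else 0.
Definition ncomp (w : word) : nat := ncomp_from [::] w.

(* Rotating the over-strand "/" counterclockwise sweeps the regions above and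
   below the crossing, so its +-resolution is the pair of vertical strands. *)
Definition resolution (plus : bool) (b : bool) (i : nat) : word :=
  if plus == b then [::] else [:: (Cap, i); (Cup, i)].

Definition plus_state (w : word) : word :=
  flatten [seq if x is (Cross b, i) then resolution true b i else [:: x]
          | x <- w].

(* Oriented diagrams: the orientation is carried by the minima and propagated
   upwards; true is an upward strand.  OCup o has its left leg oriented by o. *)
Inductive opiece := OCup of bool | OCap | OCross of bool.
Definition oletter : Type := (opiece * nat)%type.
Definition oword : Type := seq oletter.

Definition forget_piece (p : opiece) : piece :=
  match p with OCup _ => Cup | OCap => Cap | OCross b => Cross b end.
Definition forget (w : oword) : word := [seq (forget_piece x.1, x.2) | x <- w].

Definition orient_step (x : oletter) (s : seq bool) : option (seq bool) :=
  let i := x.2 in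
  let o1 := nth true s i in let o2 := nth true s i.+1 in
  match x.1 with
  | OCup o => if (i <= size s)%N
              then Some (take i s ++ [:: o; ~~ o] ++ drop i s) else None
  | OCap => if (i.+2 <= size s)%N && (o1 != o2)
            then Some (take i s ++ drop i.+2 s) else None
  | OCross _ => if (i.+2 <= size s)%N
                then Some (take i s ++ [:: o2; o1] ++ drop i.+2 s) else None
  end.

Fixpoint otarget (w : oword) (s : seq bool) : option (seq bool) :=
  if w is x :: w' then obind (otarget w') (orient_step x s) else Some s.

Record diagram := Diagram {
  diagram_word :> oword;
  diagramP : otarget diagram_word [::] = Some [::] }.

(* Signs of the crossings, true for positive.  A crossing with parallel strands
   (both up or both down) is positive iff its over-strand is "/"; reversing
   one strand changes the sign. *)
Fixpoint signs_from (s : seq bool) (w : oword) : seq bool :=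
  if w is x :: w' then
    let r := signs_from (odflt [::] (orient_step x s)) w' in
    if x.1 is OCross b
    then (b == (nth true s x.2 == nth true s x.2.+1)) :: r else r
  else [::].
Definition signs (D : diagram) : seq bool := signs_from [::] D.

Definition crossings (D : diagram) : nat := size (signs D).
Definition neg_crossings (D : diagram) : nat := count negb (signs D).
Definition writhe (D : diagram) : int :=
  (count id (signs D))%:Z - (count negb (signs D))%:Z.
Definition splus (D : diagram) : nat := ncomp (plus_state (forget D)).

(* Both sides u, v of a local move connect the same oriented endpoints s, t. *)
Definition diagram_move (D D' : diagram) : Prop :=
  exists (x u v y : oword) (s t : seq bool),
    [/\ diagram_word D = x ++ u ++ y, diagram_word D' = x ++ v ++ y,
        otarget x [::] = Some s,
        otarget u s = Some t /\ otarget v s = Some t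
      & planar_move (forget u) (forget v)
        \/ reidemeister_move (forget u) (forget v)].

Definition same_link : diagram -> diagram -> Prop :=
  clos_refl_sym_trans diagram diagram_move.

(* An oriented link in S^3, up to isotopy, as the set of its diagrams. *)
Record oriented_link := OrientedLink {
  diagrams :> set diagram;
  diagramsP : exists D0, forall D, diagrams D <-> same_link D0 D }.

Definition complexity (D : diagram) : (nat *l nat *l int)%type :=
  (neg_crossings D, crossings D, (splus D)%:Z - writhe D).

Definition minimal_diagrams (K : oriented_link) : set diagram :=
  [set D | diagrams K D /\
           forall D', diagrams K D' -> (complexity D <= complexity D')%O].

(* The ground field is Q(q^(1/4)); A = q^(-1/4) is an indeterminate generating
   the same field. *)
Definition F : fieldType := {fraction {poly rat}}.
Definition q4 : F := FracField.tofrac ('X : {poly rat}).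
Definition A : F := q4^-1.
Definition delta : F := - A ^+ 2 - A ^- 2.

(* Formal linear combinations of diagrams; they represent elements of a linear
   skein, where equality is skein_eq below. *)
Definition comb : Type := seq (F * word).

Definition comb_in (a b : nat) (f : comb) : Prop :=
  forall x, x \in f -> tangle a b x.2.
Definition comb_of (w : word) : comb := [:: (1, w)].
Definition comb_scale (c : F) (f : comb) : comb := [seq (c * x.1, x.2) | x <- f].
Definition comb_stack (f g : comb) : comb :=
  [seq (x.1 * y.1, x.2 ++ y.2) | x <- f, y <- g].
Definition comb_shift (k : nat) (f : comb) : comb :=
  [seq (x.1, shift k x.2) | x <- f].

(* Equality in the linear skein of the disc with a points at the bottom and b
   at the top; for a = b = 0 this is the skein of the plane. *)
Inductive skein_eq (a b : nat) : comb -> comb -> Prop :=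
| SE_refl f : skein_eq a b f f
| SE_sym f g : skein_eq a b f g -> skein_eq a b g f
| SE_trans f g h : skein_eq a b f g -> skein_eq a b g h -> skein_eq a b f h
| SE_add f f' g g' : skein_eq a b f f' -> skein_eq a b g g' ->
    skein_eq a b (f ++ g) (f' ++ g')
| SE_addC f g : skein_eq a b (f ++ g) (g ++ f)
| SE_merge c d w : skein_eq a b [:: (c, w); (d, w)] [:: (c + d, w)]
| SE_zero w : skein_eq a b [:: (0, w)] [::]
| SE_isotopy c x u v y : planar_move u v ->
    tangle a b (x ++ u ++ y) -> tangle a b (x ++ v ++ y) ->
    skein_eq a b [:: (c, x ++ u ++ y)] [:: (c, x ++ v ++ y)]
| SE_kauffman c x s i y : tangle a b (x ++ (Cross s, i) :: y) ->
    skein_eq a b [:: (c, x ++ (Cross s, i) :: y)]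
                 [:: (c * A, x ++ resolution true s i ++ y);
                     (c * A^-1, x ++ resolution false s i ++ y)]
| SE_circle c x i y : tangle a b (x ++ [:: (Cup, i); (Cap, i)] ++ y) ->
    skein_eq a b [:: (c, x ++ [:: (Cup, i); (Cap, i)] ++ y)]
                 [:: (c * delta, x ++ y)].

Definition bracket (f : comb) : F :=
  xget 0 [set c : F | skein_eq 0 0 f [:: (c, [::])]].

(* The generator joining the points i, i + 1, counted from 0. *)
Definition tl_gen (i : nat) : comb := comb_of [:: (Cap, i); (Cup, i)].

Inductive tl_nonunital (n : nat) : comb -> Prop :=
| TL_gen i : (i.+1 < n)%N -> tl_nonunital n (tl_gen i)
| TL_zero : tl_nonunital n [::]
| TL_add f g : tl_nonunital n f -> tl_nonunital n g -> tl_nonunital n (f ++ g)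
| TL_scale c f : tl_nonunital n f -> tl_nonunital n (comb_scale c f)
| TL_mul f g : tl_nonunital n f -> tl_nonunital n g ->
    tl_nonunital n (comb_stack f g)
| TL_eq f g : comb_in n n g -> skein_eq n n f g -> tl_nonunital n f ->
    tl_nonunital n g.

(* n nested minima (maxima) to the right of i strands. *)
Definition cups (n i : nat) : word := [seq (Cup, (i + k)%N) | k <- iota 0 n].
Definition caps (n i : nat) : word :=
  [seq (Cap, (i + k)%N) | k <- rev (iota 0 n)].

Definition planar_closure (n : nat) (f : comb) : comb :=
  comb_stack (comb_of (cups n 0)) (comb_stack f (comb_of (caps n 0))).

Definition triangle (n : nat) : F :=
  (-1) ^+ n * (A ^+ (2 * n.+1) - A ^- (2 * n.+1)) / (A ^+ 2 - A ^- 2).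

Definition is_jones_wenzl (n : nat) (f : comb) : Prop :=
  [/\ comb_in n n f,
      forall i, (i.+1 < n)%N ->
        skein_eq n n (comb_stack f (tl_gen i)) [::] /\
        skein_eq n n (comb_stack (tl_gen i) f) [::],
      tl_nonunital n (f ++ comb_scale (-1) (comb_of [::])),
      skein_eq n n (comb_stack f f) f
    & skein_eq 0 0 (planar_closure n f) [:: (triangle n, [::])]].

Definition jones_wenzl (n : nat) : comb :=
  xget [::] [set f : comb | is_jones_wenzl n f].

(* m parallel copies of a piece, along the blackboard framing. *)
Definition cable_letter (m : nat) (x : letter) : word :=
  match x.1 with
  | Cup => cups m (m * x.2)
  | Cap => caps m (m * x.2)
  | Cross b =>
      [seq (Cross b, (m * x.2 + j + k)%N) | j <- iota 0 m, k <- rev (iota 0 m)]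
  end.

(* The m-cable of w with one copy of f inserted in each component: on the left
   strand of the maximum at which the component gets closed. *)
Fixpoint colored_from (m : nat) (f : comb) (l : seq nat) (w : word) : comb :=
  if w is x :: w' then
    comb_stack
      (if closes x l then comb_shift (m * x.2) f else comb_of [::])
      (comb_stack (comb_of (cable_letter m x))
                  (colored_from m f (label_step x l) w'))
  else comb_of [::].

Definition colored (m : nat) (D : diagram) : comb :=
  colored_from m (jones_wenzl m) [::] (forget D).

(* The n-th colored Jones polynomial, n >= 2, evaluated on the diagram D itself:
   its invariance under same_link is not built into the definition. *)
Definition colored_jones (n : nat) (D : diagram) : F :=
  ((-1) ^+ n.-1 * q4 ^+ (n.-1 ^ 2 + 2 * n.-1)) ^ (writhe D)
  * bracket (colored n.-1 D).

(* Coefficient of X^n in the power series p / d, when d has a nonzero constant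
   term. *)
Fixpoint series_coef (p d : {poly rat}) (n : nat) : rat :=
  let c := p`_0 / d`_0 in
  if n is n'.+1 then series_coef (drop_poly 1 (p - c *: d)) d n' else c.

(* Coefficient of q4 ^ k in the Laurent series of x at q4 = 0; on Laurent
   polynomials it is the usual coefficient. *)
Definition laurent_coef (x : F) (k : int) : rat :=
  let: (p, d) := (\n_(repr x), \d_(repr x)) in
  let v := mup 0 d in
  if k + v%:Z is Posz n then series_coef p (drop_poly v d) n else 0.

Definition q_coef (x : F) (e : rat) : rat :=
  if 4 * e \is a Num.int then laurent_coef x (numq (4 * e)) else 0.

Definition h (n : nat) (D : diagram) : rat :=
  let m : rat := n%:R - 1 in
  - (1 / 4) * (m ^+ 2 * (crossings D)%:R + 2 * m * (splus D)%:R)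
  + (m ^+ 2 + 2 * m) / 4 * (writhe D)%:~R.

Definition beta (i : nat) (D : diagram) : rat :=
  q_coef (colored_jones i D) (h i D + i%:R - 3).

(* The power series J_D^+, as its sequence of coefficients. *)
Definition Jplus (D : diagram) : nat -> rat :=
  fun i => if (3 <= i)%N then beta i D else 0.

(* Main.v *)
(* The complexity of D determines c(D), s_+(D) and the writhe, hence h_n(D); so
   everything rests on the invariance of the colored Jones polynomial, which is
   proved in an algebra where skeins become elements and isotopies equalities.

   An algebra with a shift endomorphism, a cup u and a cap n subject to the
   zigzag and circle relations receives all words at once (strands to the right
   are ignored, so no arities are needed).  One such algebra acts on functions of
   infinite bit sequences; as closed words reduce to scalars, it computes the
   bracket.  There, parallel strands slide over and under cups and caps, which
   gives the cabled moves RM2 and RM3.  The projector P = 1 + x kills the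
   generators e_i, so it is idempotent, passes through crossings and extrema, and
   absorbs the crossings of a cabled curl up to the power of A that the writhe
   factor compensates.  Since P slides along a component, one projector per
   component may be replaced by one above every minimum, and in that form each
   move is checked locally. *)

From HB Require Import structures.
From Stdlib Require Import Relation_Operators.
From mathcomp Require Import all_boot all_order all_algebra.
From mathcomp Require Import boolp classical_sets.
From mathcomp Require Import zify ring.
Require Import Defs.

Set Implicit Arguments.
Unset Strict Implicit.
Unset Printing Implicit Defensive.

Import Order.TTheory GRing.Theory Num.Theory.
Local Open Scope ring_scope.

(** [bracket f] is a chosen scalar [c] such that [f] is skein-equal to [c] times the empty word.
    Rewriting shows that some [c] exists; that it is determined by [f] can only be seen through an
    invariant, and an algebra with [1 != 0] supplies one. The operators come from the representation
    of the Temperley-Lieb category on tensor powers of a two-dimensional space: one bit per strand,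
    an antidiagonal pairing for a maximum and its inverse for a minimum, scaled so that a circle has
    the value [- a^2 - a^-2].

    What prevents a move-by-move proof is that the projector of a component sits at its last
    maximum, a place that depends on the whole word. Projectors above all the minima remove this
    dependence, but a cancelled zigzag then leaves a projector behind. It disappears because every
    strand entering a move comes from minima below, so that the lower part of the word already ends
    in projectors. *)

Record skein_model (K : fieldType) (a : K) := SkeinModel {
  skein_alg :> algType K;
  skein_neq0 : a != 0;
  skein_shift : {lrmorphism skein_alg -> skein_alg};
  skein_cup : skein_alg;
  skein_cap : skein_alg;
  skein_cupL : forall x, skein_cup * skein_shift (skein_shift x) = x * skein_cup;
  skein_capL : forall x, skein_cap * x = skein_shift (skein_shift x) * skein_cap;
  skein_zigzagl : skein_cup * skein_shift skein_cap = 1;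
  skein_zigzagr : skein_shift skein_cup * skein_cap = 1;
  skein_circle : skein_cup * skein_cap = (- a ^+ 2 - a ^- 2) *: 1 }.

(** * Planar algebra in a skein model *)

Section SkeinAlgebra.
Variables (K : fieldType) (a : K) (E : skein_model a).
Implicit Types (x y z t : E) (b c : bool) (i j k m p q r : nat).

Definition sh k x : E := iter k (@skein_shift K a E) x.

Lemma shM k x y : sh k (x * y) = sh k x * sh k y.
Proof. by elim: k => //= k ->; rewrite rmorphM. Qed.
Lemma sh1 k : sh k 1 = 1.
Proof. by elim: k => //= k ->; rewrite rmorph1. Qed.
Lemma shD k x y : sh k (x + y) = sh k x + sh k y.
Proof. by elim: k => //= k ->; rewrite rmorphD. Qed.
Lemma sh0 k : sh k 0 = 0.
Proof. by elim: k => //= k ->; rewrite rmorph0. Qed.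
Lemma shZ k d x : sh k (d *: x) = d *: sh k x.
Proof. by elim: k => //= k ->; rewrite linearZ. Qed.
Lemma sh_sh j k x : sh j (sh k x) = sh (j + k) x.
Proof. by rewrite /sh iterD. Qed.

(* [x] is supported on a leftmost disc with [p] points below and [q] above. *)
Definition local p q x := forall y, x * sh q y = sh p y * x.

Lemma local1 p : local p p 1.
Proof. by move=> y; rewrite mulr1 mul1r. Qed.
Lemma local0 p q : local p q 0.
Proof. by move=> y; rewrite mulr0 mul0r. Qed.
Lemma localM p q r x y : local p q x -> local q r y -> local p r (x * y).
Proof. by move=> hx hy z; rewrite -mulrA hy mulrA hx mulrA. Qed.
Lemma localD p q x y : local p q x -> local p q y -> local p q (x + y).
Proof. by move=> hx hy z; rewrite mulrDl mulrDr hx hy. Qed.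
Lemma localZ p q d x : local p q x -> local p q (d *: x).
Proof. by move=> hx z; rewrite -scalerAl -scalerAr hx. Qed.
Lemma local_sh k p q x : local p q x -> local (k + p) (k + q) (sh k x).
Proof. by move=> hx z; rewrite -!sh_sh -!shM hx. Qed.
Lemma local_widen k p q x : local p q x -> local (p + k) (q + k) x.
Proof. by move=> hx z; rewrite -!sh_sh hx. Qed.
Lemma local_le i j p q x : (p <= i)%N -> (i + q = j + p)%N ->
  local p q x -> local i j x.
Proof.
move=> le_pi eq_ij hx.
have -> : i = (p + (i - p))%N by lia.
have -> : j = (q + (i - p))%N by lia.
exact: local_widen.
Qed.

(** * Extrema, hooks and crossings *)

Definition cup i : E := sh i (@skein_cup K a E).
Definition cap i : E := sh i (@skein_cap K a E).
Definition tl i : E := cap i * cup i.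

Lemma sh_cup k i : sh k (cup i) = cup (k + i).
Proof. exact: sh_sh. Qed.
Lemma sh_cap k i : sh k (cap i) = cap (k + i).
Proof. exact: sh_sh. Qed.
Lemma sh_tl k i : sh k (tl i) = tl (k + i).
Proof. by rewrite shM sh_cup sh_cap. Qed.

Lemma local_cup i : local i i.+2 (cup i).
Proof.
have /(local_sh i) h : local 0 2 (@skein_cup K a E) by move=> x; exact: skein_cupL.
by move: h; rewrite addn0 addn2.
Qed.
Lemma local_cap i : local i.+2 i (cap i).
Proof.
have /(local_sh i) h : local 2 0 (@skein_cap K a E) by move=> x; exact: skein_capL.
by move: h; rewrite addn0 addn2.
Qed.
Lemma local_tl i : local i.+2 i.+2 (tl i).
Proof. exact: localM (local_cap i) (local_cup i). Qed.

Lemma cup_far i j x : (i <= j)%N -> cup i * sh j.+2 x = sh j x * cup i.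
Proof. by move=> h; apply: local_le (local_cup i) x; lia. Qed.
Lemma cap_far i j x : (i <= j)%N -> cap i * sh j x = sh j.+2 x * cap i.
Proof. by move=> h; apply: local_le (local_cap i) x; lia. Qed.

Lemma cup_capS i : cup i * cap i.+1 = 1.
Proof. by rewrite /cup /cap -addn1 -!sh_sh -shM /= skein_zigzagl sh1. Qed.
Lemma cupS_cap i : cup i.+1 * cap i = 1.
Proof. by rewrite /cup /cap -addn1 -!sh_sh -shM /= skein_zigzagr sh1. Qed.
Lemma cup_cap i : cup i * cap i = (- a ^+ 2 - a ^- 2) *: 1.
Proof. by rewrite -shM skein_circle shZ sh1. Qed.

Definition coef b : K := if b then a else a^-1.
Lemma coef_neq0 b : coef b != 0.
Proof. by case: b; rewrite ?invr_eq0 (skein_neq0 E). Qed.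
Lemma coefN b : coef (~~ b) = (coef b)^-1.
Proof. by case: b; rewrite ?invrK. Qed.

Definition crossing b i : E := coef b *: 1 + coef (~~ b) *: tl i.

Lemma sh_crossing k b i : sh k (crossing b i) = crossing b (k + i).
Proof. by rewrite shD !shZ sh1 sh_tl. Qed.
Lemma local_crossing b i : local i.+2 i.+2 (crossing b i).
Proof.
by apply: localD; apply: localZ; [exact: local1|exact: local_tl].
Qed.

(** The value of a circle is symmetric in [a] and its inverse, so [coef b] can play the role of [a]
    and both kinds of crossing are treated at once. *)
Lemma circle_coef b : - a ^+ 2 - a ^- 2 = - coef b ^+ 2 - coef b ^- 2.
Proof. by case: b; rewrite /= ?exprVn ?invrK // addrC. Qed.

(** With [c = coef b], a kink is worth [c + c^-1 (- c^2 - c^-2) = - c^-3]. *)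
Definition curl b : K := - coef b ^- 3.

Lemma cup_crossing b i : cup i * crossing b i = curl b *: cup i.
Proof.
rewrite mulrDr -!scalerAr mulr1 mulrA cup_cap -scalerAl mul1r scalerA -scalerDl.
congr (_ *: _); rewrite (circle_coef b) coefN /curl.
by field; rewrite coef_neq0.
Qed.

Lemma cupS_crossing b i :
  cup i.+1 * crossing b i = coef b *: cup i.+1 + coef (~~ b) *: cup i.
Proof. by rewrite mulrDr -!scalerAr mulr1 mulrA cupS_cap mul1r. Qed.
Lemma cup_crossingS b i :
  cup i * crossing b i.+1 = coef b *: cup i + coef (~~ b) *: cup i.+1.
Proof. by rewrite mulrDr -!scalerAr mulr1 mulrA cup_capS mul1r. Qed.
Lemma crossing_capS b i :
  crossing b i * cap i.+1 = coef b *: cap i.+1 + coef (~~ b) *: cap i.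
Proof. by rewrite mulrDl -!scalerAl mul1r -mulrA cup_capS mulr1. Qed.
Lemma crossingS_cap b i :
  crossing b i.+1 * cap i = coef b *: cap i + coef (~~ b) *: cap i.+1.
Proof. by rewrite mulrDl -!scalerAl mul1r -mulrA cupS_cap mulr1. Qed.

Lemma crossingK b i : crossing b i * crossing (~~ b) i = 1.
Proof.
rewrite {1}/crossing mulrDl -!scalerAl mul1r -mulrA cup_crossing -scalerAr.
rewrite /crossing negbK /curl scalerDr !scalerA -addrA -/(tl i) -scalerDl coefN.
rewrite mulfV ?coef_neq0 // scale1r.
rewrite [X in X *: _](_ : _ = 0) ?scale0r ?addr0 // exprVn invrK.
by field; rewrite coef_neq0.
Qed.

(** A strand passes a minimum: once both crossings are resolved, [cup i.+1] has the coefficient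
    [coef b * curl b + coef b ^- 2 = 0]. *)
Lemma cup_over b i : cup i.+1 * crossing b i * crossing b i.+1 = cup i.
Proof.
rewrite cupS_crossing mulrDl -!scalerAl cup_crossing cup_crossingS.
rewrite scalerDr !scalerA (addrC (_ *: cup i)) addrA -scalerDl.
rewrite coefN mulVf ?coef_neq0 // scale1r.
rewrite [X in X *: _](_ : _ = 0) ?scale0r ?add0r // /curl.
by field; rewrite coef_neq0.
Qed.

Lemma crossing_cap b i : crossing b i * cap i = curl b *: cap i.
Proof.
rewrite mulrDl -!scalerAl mul1r -mulrA cup_cap -scalerAr mulr1 scalerA -scalerDl.
congr (_ *: _); rewrite (circle_coef b) coefN /curl.
by field; rewrite coef_neq0.
Qed.

Lemma cap_over b i : crossing b i * crossing b i.+1 * cap i = cap i.+1.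
Proof.
rewrite -mulrA crossingS_cap mulrDr -!scalerAr crossing_cap crossing_capS.
rewrite scalerDr !scalerA (addrC (_ *: cap i.+1)) addrA -scalerDl.
rewrite coefN mulVf ?coef_neq0 // scale1r.
rewrite [X in X *: _](_ : _ = 0) ?scale0r ?add0r // /curl.
by field; rewrite coef_neq0.
Qed.

(** * Grids of crossings and sliding *)

Fixpoint lrow b i n : E := if n is n'.+1 then crossing b (i + n') * lrow b i n' else 1.
Fixpoint rrow b i n : E := if n is n'.+1 then rrow b i n' * crossing b (i + n') else 1.
(** A row [lrow] carries one strand leftwards across [n] strands, [rrow] carries one rightwards. The
    grid exchanges a left block of [p] strands with a right block of [q] strands; for [b = true] the
    [p] strands are on top. *)
Fixpoint grid b i p q : E := if q is q'.+1 then grid b i p q' * lrow b (i + q') p else 1.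

Lemma sh_lrow k b i p : sh k (lrow b i p) = lrow b (k + i) p.
Proof. by elim: p => [|p ih] /=; rewrite ?sh1 // shM ih sh_crossing addnA. Qed.
Lemma sh_rrow k b i p : sh k (rrow b i p) = rrow b (k + i) p.
Proof. by elim: p => [|p ih] /=; rewrite ?sh1 // shM ih sh_crossing addnA. Qed.
Lemma sh_grid k b i p q : sh k (grid b i p q) = grid b (k + i) p q.
Proof. by elim: q => [|q ih] /=; rewrite ?sh1 // shM ih sh_lrow addnA. Qed.

Lemma local_lrow b i p : local (i + p).+1 (i + p).+1 (lrow b i p).
Proof.
elim: p => [|p ih] /=; first exact: local1.
rewrite addnS; apply: localM (local_crossing b _) _.
by apply: local_le ih; lia.
Qed.
Lemma local_grid b i p q : local (i + p + q) (i + p + q) (grid b i p q).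
Proof.
elim: q => [|q ih] /=; first exact: local1.
rewrite addnS; apply: (@localM _ (i + p + q).+1).
  by apply: local_le ih; lia.
by apply: local_le (local_lrow b _ _); lia.
Qed.

Lemma grid_far b i p q j x : (i + p + q <= j)%N ->
  grid b i p q * sh j x = sh j x * grid b i p q.
Proof. by move=> h; apply: local_le (local_grid b i p q) x; lia. Qed.

Lemma rrowK b i p : rrow b i p * lrow (~~ b) i p = 1.
Proof.
elim: p => [|p ih] /=; first by rewrite mulr1.
by rewrite mulrA -(mulrA (rrow _ _ _)) crossingK mulr1.
Qed.
Lemma lrowK b i p : lrow b i p * rrow (~~ b) i p = 1.
Proof.
elim: p => [|p ih] /=; first by rewrite mulr1.
by rewrite mulrA -(mulrA (crossing _ _)) ih mulr1 crossingK.
Qed.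

Lemma grid0l b i q : grid b i 0 q = 1.
Proof. by elim: q => //= q ->; rewrite mulr1. Qed.
Lemma grid1r b i p : grid b i p 1 = lrow b i p.
Proof. by rewrite /= mul1r addn0. Qed.

Lemma rrow2 b i : rrow b i 2 = crossing b i * crossing b i.+1.
Proof. by rewrite /= mul1r addn0 addn1. Qed.

Lemma grid2r b p : grid b 0 p 2 = lrow b 0 p * lrow b 1 p.
Proof. by rewrite /= mul1r. Qed.

Lemma grid_addr b i p q r : grid b i p (q + r) = grid b i p q * grid b (i + q) p r.
Proof.
elim: r => [|r ih]; first by rewrite addn0 mulr1.
by rewrite addnS /= ih mulrA addnA.
Qed.

(** The recursion of [grid] adds a strand to the right block; this one adds a strand to the left
    block. Having both lets two opposite grids cancel row by row. *)
Lemma grid_Sl b i p q : grid b i p.+1 q = rrow b (i + p) q * grid b i p q.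
Proof.
elim: q => [|q ih] /=; first by rewrite mulr1.
rewrite ih -!mulrA; congr (_ * _); rewrite !mulrA; congr (_ * _).
rewrite (addnAC i q p) -[(i + p + q)%N]addn0 -sh_crossing.
by rewrite grid_far.
Qed.

Lemma gridK b i p q : grid b i p q * grid (~~ b) i q p = 1.
Proof.
elim: q => [|q ih]; first by rewrite grid0l mulr1.
by rewrite grid_Sl /= mulrA -(mulrA (grid _ _ _ _)) lrowK mulr1.
Qed.

(* [x] may be passed across [p] strands, all of them over it or all under it. *)
Definition slides q r x := forall b p, sh p x * grid b 0 p r = grid b 0 p q * x.

Lemma slides1 p : slides p p 1.
Proof. by move=> b k; rewrite sh1 mul1r mulr1. Qed.
Lemma slides0 p q : slides p q 0.
Proof. by move=> b k; rewrite sh0 mul0r mulr0. Qed.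
Lemma slidesM p q r x y : slides p q x -> slides q r y -> slides p r (x * y).
Proof. by move=> hx hy b k; rewrite shM -mulrA hy mulrA hx mulrA. Qed.
Lemma slidesD p q x y : slides p q x -> slides p q y -> slides p q (x + y).
Proof. by move=> hx hy b k; rewrite shD mulrDl mulrDr hx hy. Qed.
Lemma slidesZ p q d x : slides p q x -> slides p q (d *: x).
Proof. by move=> hx b k; rewrite shZ -scalerAl -scalerAr hx. Qed.

Lemma grid_widen b i p j q r : grid b i p (j + q + r) =
  grid b i p j * grid b (i + j) p q * grid b (i + j + q) p r.
Proof. by rewrite !grid_addr addnA. Qed.

(** The grid is cut into three parts, across the [j] strands to the left of [x], across [x], and
    across the [r] strands to its right. Only the middle part interacts with [x]; the others commute
    with it by locality. *)
Lemma slides_widen j q q' r x : local q q' x -> slides q q' x ->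
  slides (j + q + r) (j + q' + r) (sh j x).
Proof.
move=> lx sx b p; rewrite !grid_widen !add0n.
have -> : grid b j p q' = sh j (grid b 0 p q') by rewrite sh_grid addn0.
have -> : grid b j p q = sh j (grid b 0 p q) by rewrite sh_grid addn0.
have -> : grid b (j + q') p r = sh j (sh q' (grid b 0 p r)).
  by rewrite !sh_grid addn0.
have -> : grid b (j + q) p r = sh j (sh q (grid b 0 p r)).
  by rewrite !sh_grid addn0.
rewrite sh_sh addnC -(sh_sh j p) !mulrA.
have -> : sh j (sh p x) * grid b 0 p j = grid b 0 p j * sh j (sh p x).
  by rewrite !sh_sh grid_far // add0n addnC.
rewrite -(mulrA (grid _ _ _ _)) -shM sx shM -!mulrA -!shM.
by rewrite lx.
Qed.

Lemma slides_cup0 : slides 0 2 (cup 0).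
Proof.
move=> b p; rewrite sh_cup addn0 mul1r.
elim: p => [|p ih]; first by rewrite grid0l mulr1.
by rewrite grid_Sl add0n rrow2 mulrA [X in X * _]mulrA cup_over.
Qed.
Lemma slides_cap0 : slides 2 0 (cap 0).
Proof.
move=> b p; rewrite sh_cap addn0 mulr1.
elim: p => [|p ih]; first by rewrite grid0l mul1r.
by rewrite grid_Sl add0n rrow2 -mulrA -ih cap_over.
Qed.

Lemma slides_cup i p : (i <= p)%N -> slides p p.+2 (cup i).
Proof.
move=> h; have := slides_widen i (p - i) (local_cup 0) slides_cup0.
by rewrite sh_cup addn0 (_ : i + (p - i) = p)%N 1?(_ : i + 2 + (p - i) = p.+2)%N //; lia.
Qed.
Lemma slides_cap i p : (i <= p)%N -> slides p.+2 p (cap i).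
Proof.
move=> h; have := slides_widen i (p - i) (local_cap 0) slides_cap0.
by rewrite sh_cap addn0 (_ : i + (p - i) = p)%N 1?(_ : i + 2 + (p - i) = p.+2)%N //; lia.
Qed.
Lemma slides_tl i p : (i.+1 < p)%N -> slides p p (tl i).
Proof.
case: p => [|[|p]] // h.
by apply: slidesM (slides_cap _) (slides_cup _); lia.
Qed.
(** Kauffman's argument for the third Reidemeister move: a crossing can be passed because both of
    its resolutions can. *)
Lemma slides_crossing b i p : (i.+1 < p)%N -> slides p p (crossing b i).
Proof.
by move=> h; apply: slidesD; apply: slidesZ; [exact: slides1|exact: slides_tl].
Qed.

Lemma slides_lrow b i n p : (i + n < p)%N -> slides p p (lrow b i n).
Proof.
elim: n => [|n ih] h /=; first exact: slides1.
by apply: slidesM (ih _); [apply: slides_crossing|]; lia.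
Qed.
Lemma slides_rrow b i n p : (i + n < p)%N -> slides p p (rrow b i n).
Proof.
elim: n => [|n ih] h /=; first exact: slides1.
by apply: slidesM; [apply: ih|apply: slides_crossing]; lia.
Qed.
Lemma slides_grid b i p q r : (i + p + q <= r)%N -> slides r r (grid b i p q).
Proof.
elim: q => [|q ih] h /=; first exact: slides1.
by apply: slidesM; [apply: ih|apply: slides_lrow]; lia.
Qed.

(** The strands now come from the right. This is [slides] for [~~ b] multiplied on both sides by the
    inverse grids. *)
Lemma slides_left q r x : slides q r x ->
  forall b p, x * grid b 0 r p = grid b 0 q p * sh p x.
Proof.
move=> hx b p; rewrite -[LHS]mul1r -(gridK b 0 q p) -mulrA; congr (_ * _).
rewrite mulrA -hx -mulrA; have := gridK (~~ b) 0 p r.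
by rewrite negbK => ->; rewrite mulr1.
Qed.

(** * Nested minima and maxima *)

Fixpoint cups_el n : E := if n is n'.+1 then cups_el n' * cup n' else 1.
Fixpoint caps_el n : E := if n is n'.+1 then cap n' * caps_el n' else 1.

Lemma cups_elS n : cups_el n.+1 = cups_el n * cup n.
Proof. by []. Qed.
Lemma caps_elS n : caps_el n.+1 = cap n * caps_el n.
Proof. by []. Qed.

Lemma local_cups_el m : local 0 (m + m) (cups_el m).
Proof.
elim: m => [|m ih] /=; first exact: local1.
apply: localM ih _.
by apply: local_le (local_cup _); lia.
Qed.
Lemma local_caps_el m : local (m + m) 0 (caps_el m).
Proof.
elim: m => [|m ih] /=; first exact: local1.
apply: localM _ ih.
by apply: local_le (local_cap _); lia.
Qed.
Lemma slides_cups_el m : slides 0 (m + m) (cups_el m).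
Proof.
elim: m => [|m ih] /=; first exact: slides1.
apply: slidesM ih _; rewrite addSn addnS.
by apply: slides_cup; lia.
Qed.
Lemma slides_caps_el m : slides (m + m) 0 (caps_el m).
Proof.
elim: m => [|m ih] /=; first exact: slides1.
apply: slidesM _ ih; rewrite addSn addnS.
by apply: slides_cap; lia.
Qed.

(** Splits off the outermost minimum instead of the innermost one: in a cabled zigzag it is the
    outermost minimum that meets the innermost maximum. *)
Lemma cups_elSl m : cups_el m.+1 = cup 0 * sh 1 (cups_el m).
Proof.
elim: m => [|m ih]; first by rewrite (sh1 1) mulr1 [LHS]mul1r.
by rewrite -[LHS]/(cups_el m.+1 * cup m.+1) {1}ih -mulrA -(sh_cup 1) -shM.
Qed.

Lemma cups_caps_el m : cups_el m * sh m (caps_el m) = 1.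
Proof.
elim: m => [|m ih]; first by rewrite mulr1.
rewrite cups_elSl caps_elS shM sh_cap -mulrA (mulrA (sh 1 _)).
have -> : sh 1 (cups_el m) * cap (m.+1 + m) = cap 1 * sh 1 (cups_el m).
  have capE i : cap i = sh i (cap 0) by rewrite sh_cap addn0.
  rewrite (capE (m.+1 + m)%N) (capE 1%N).
  by apply: local_le (local_sh 1 (local_cups_el m)) _; lia.
rewrite !mulrA cup_capS mul1r -[m.+1]add1n -sh_sh -shM ih.
exact: sh1.
Qed.

Lemma sh_cups_caps_el m : sh m (cups_el m) * caps_el m = 1.
Proof.
elim: m => [|m ih]; first by rewrite mulr1.
rewrite cups_elSl caps_elS shM sh_cup addn0 sh_sh addn1 mulrA.
by rewrite -(mulrA (cup _)) -cap_far // mulrA cupS_cap mul1r.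
Qed.

(** A block of [m] strands can be passed across both legs of the minima; [gridK] moves its crossing
    with the right leg to the other side. *)
Lemma cups_el_grid b m :
  cups_el m * grid b m m m = sh m (cups_el m) * grid (~~ b) 0 m m.
Proof.
have := slides_cups_el m (~~ b) m; rewrite grid_addr add0n /= mul1r => {1}<-.
have := congr1 (sh m) (gridK (~~ b) 0 m m).
rewrite shM !sh_grid addn0 sh1 negbK => h.
by rewrite -!mulrA h mulr1.
Qed.

Lemma grid_caps_el b m :
  grid b 0 m m * sh m (caps_el m) = grid (~~ b) m m m * caps_el m.
Proof.
have := slides_caps_el m (~~ b) m; rewrite grid_addr add0n /= mulr1 => ->.
have := gridK b 0 m m => h.
by rewrite -!mulrA mulrA h mul1r.
Qed.

(** * Absorbed crossings and the twist of a cable *)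

Lemma lrow_absorb b i p x : (forall j, (j < p)%N -> tl (i + j) * x = 0) ->
  lrow b i p * x = coef b ^+ p *: x.
Proof.
elim: p => [|p ih] h /=; first by rewrite mul1r scale1r.
rewrite -mulrA ih => [|j lt_jp]; last by apply: h; lia.
rewrite -scalerAr mulrDl -!scalerAl h // mul1r scaler0 addr0 scalerA.
by rewrite -exprSr.
Qed.
Lemma rrow_absorb b i p x : (forall j, (j < p)%N -> tl (i + j) * x = 0) ->
  rrow b i p * x = coef b ^+ p *: x.
Proof.
elim: p => [|p ih] h /=; first by rewrite mul1r scale1r.
rewrite -mulrA mulrDl -!scalerAl h // mul1r scaler0 addr0 -scalerAr.
rewrite ih ?scalerA -?exprS // => j lt_jp; apply: h; lia.
Qed.

(** Carrying the left leg of a minimum to the left amounts to forming the minimum there and carrying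
    its right leg back. *)
Lemma cup_lrow b n : cup n * lrow b 0 n = cup 0 * rrow (~~ b) 1 n.
Proof.
have := slides_cup0 b n; rewrite sh_cup addn0 grid2r [RHS]mul1r => <-.
by rewrite -!mulrA lrowK mulr1.
Qed.

(** A row slides through the grid of [n] by [n.+1] strands. Splitting off the first row of this grid
    on one side and the last row on the other, then cancelling the last row, produces the inverse
    row at the end. *)
Lemma rrow_grid b n : rrow b n.+1 n * grid b 1 n n =
  lrow b 1 n * grid b 2 n n * rrow b 1 n * rrow (~~ b) n.+1 n.
Proof.
have lt_n : (0 + n < n.+1)%N by [].
have := slides_rrow b lt_n b n.
rewrite -add1n grid_addr grid1r sh_rrow addn0 add0n => h.
have {}h : rrow b n n * grid b 0 n n =
    lrow b 0 n * grid b 1 n n * rrow b 0 n * rrow (~~ b) n n.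
  have e : lrow b 0 n * grid b 1 n n = grid b 0 n n * lrow b n n.
    by rewrite -grid1r -(grid_addr b 0 n 1 n).
  by rewrite -h e -!mulrA lrowK mulr1.
have := congr1 (sh 1) h; rewrite !shM !sh_rrow !sh_grid sh_lrow.
by rewrite !add1n.
Qed.

(** The exponent is [3 m + m (m - 1)]: a kink on each of the [m] strands, and one absorbed factor
    for each of the other crossings of the grid. *)
Definition twist b m : K := (-1) ^+ m * coef b ^- (m ^ 2 + 2 * m).

(** The factor gained when one strand is pulled out: its own kink and its [m + m] absorbed crossings
    with the others. *)
Lemma twistS b m : twist b m.+1 = curl b * coef (~~ b) ^+ (m + m) * twist b m.
Proof.
rewrite /twist /curl coefN exprVn exprS -!mulrA mulN1r mulNr; congr (- _).
rewrite (mulrCA (coef b ^- (m + m))) (mulrCA (coef b ^- 3)) -!invfM -!exprD.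
by congr (_ * (_ ^+ _)^-1); lia.
Qed.

(* The innermost strand is uncurled and pulled out between the two blocks; all
   the crossings that it still makes are absorbed by [x]. *)
Lemma cups_el_twist b m x :
  (forall j, (j.+1 < m)%N -> tl j * x = 0) ->
  (forall j, (j.+1 < m)%N -> tl (m + j) * x = 0) ->
  cups_el m * grid b 0 m m * x = twist b m *: (cups_el m * x).
Proof.
elim: m x => [|n ih] x h1 h2.
  by rewrite /= !mul1r /twist mul1r invr1 scale1r.
have -> : grid b 0 n.+1 n.+1 =
    crossing b n * lrow b 0 n * (rrow b n.+1 n * grid b 1 n n).
  by rewrite -[X in grid b 0 _ X]add1n grid_addr grid1r /= grid_Sl !add0n.
rewrite /= rrow_grid -!mulrA (mulrA (cup n)) cup_crossing -scalerAl -scalerAr.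
rewrite (mulrA (cup n)) cup_lrow -!mulrA (mulrA (rrow _ 1 n)).
have := rrowK (~~ b) 1 n; rewrite negbK => ->; rewrite mul1r.
rewrite (mulrA (cup 0)).
have -> : cup 0 * grid b 2 n n = grid b 0 n n * cup 0.
  by rewrite -(sh_grid 2 b 0) cup_far.
rewrite -!mulrA (@rrow_absorb _ n.+1) => [|j lt_jn]; last by apply: h2.
rewrite -!scalerAr (mulrA (cup 0)).
have := cup_lrow (~~ b) n; rewrite negbK => <-.
rewrite -mulrA lrow_absorb => [|j lt_jn]; last by apply: h1.
rewrite -!scalerAr mulrA ih.
- by rewrite !scalerA twistS exprD !mulrA.
- move=> j lt_jn; rewrite mulrA.
  have -> : tl j * cup n = cup n * tl j.
    rewrite -[n]addn0 -sh_cup; apply: local_le (local_tl j) _; lia.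
  by rewrite -mulrA h1 ?mulr0 // ltnW.
- move=> j lt_jn; rewrite mulrA.
  rewrite -[(n + j)%N]addn0 -sh_tl -cup_far ?leq_addr // sh_tl -mulrA.
  by rewrite addn0 -addnS -addSn h2 ?mulr0.
Qed.

(** A hook follows two neighbouring minima down one block of legs and up the other. Nesting reverses
    the order of the strands, which gives the index [n - i.+2]. *)
Lemma cups_el_tl n i : (i.+1 < n)%N ->
  cups_el n * tl i = cups_el n * sh n (tl (n - i.+2)).
Proof.
rewrite sh_tl; elim: n => [|n ih] //; rewrite ltnS leq_eqVlt => /orP[/eqP <-|h].
  rewrite 2!cups_elS subnn addn0 -!mulrA; congr (_ * _).
  rewrite /tl (mulrA (cup i.+1)) cupS_cap mul1r (mulrA (cup i.+1)) cup_capS mul1r.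
  have cupE j : cup j = sh j (cup 0) by rewrite sh_cup addn0.
  by rewrite (cupE i.+2) cup_far // sh_cup addn0.
have tlE j : tl j = sh j (tl 0) by rewrite sh_tl addn0.
rewrite cups_elS -!mulrA.
have -> : cup n * tl i = tl i * cup n.
  by rewrite -(addn0 n) -sh_cup; apply/esym; apply: local_le (local_tl i) _; lia.
rewrite mulrA ih //.
have -> : (n.+1 + (n.+1 - i.+2) = (n + (n - i.+2)).+2)%N by lia.
by rewrite (tlE (_.+2)) cup_far ?leq_addr // -tlE mulrA.
Qed.

Lemma tl_caps_el n i : (i.+1 < n)%N ->
  tl i * caps_el n = sh n (tl (n - i.+2)) * caps_el n.
Proof.
rewrite sh_tl; elim: n => [|n ih] //; rewrite ltnS leq_eqVlt => /orP[/eqP <-|h].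
  rewrite 2!caps_elS subnn addn0 !mulrA; congr (_ * _).
  rewrite /tl -(mulrA (cap i)) cup_capS mulr1 -(mulrA _ _ (cap i.+1)) cupS_cap mulr1.
  have capE j : cap j = sh j (cap 0) by rewrite sh_cap addn0.
  by rewrite (capE i.+2) -cap_far // sh_cap addn0.
have tlE j : tl j = sh j (tl 0) by rewrite sh_tl addn0.
rewrite caps_elS !mulrA.
have -> : tl i * cap n = cap n * tl i.
  by rewrite -(addn0 n) -sh_cap; apply: local_le (local_tl i) _; lia.
rewrite -mulrA ih //.
have -> : (n.+1 + (n.+1 - i.+2) = (n + (n - i.+2)).+2)%N by lia.
by rewrite (tlE (_.+2)) -cap_far ?leq_addr // -tlE mulrA.
Qed.

(** * The algebra generated by hooks, and the projector *)

Inductive tl_ideal m : E -> Prop :=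
| TLI_gen i : (i.+1 < m)%N -> tl_ideal m (tl i)
| TLI_zero : tl_ideal m 0
| TLI_add x y : tl_ideal m x -> tl_ideal m y -> tl_ideal m (x + y)
| TLI_scale d x : tl_ideal m x -> tl_ideal m (d *: x)
| TLI_mul x y : tl_ideal m x -> tl_ideal m y -> tl_ideal m (x * y).

Lemma local_tl_ideal m x : tl_ideal m x -> local m m x.
Proof.
elim => [i h||||].
- by apply: local_le (local_tl i); lia.
- exact: local0.
- by move=> *; exact: localD.
- by move=> *; exact: localZ.
- by move=> y z _ hy _ hz; exact: localM hy hz.
Qed.
Lemma slides_tl_ideal m x : tl_ideal m x -> slides m m x.
Proof.
elim => [i h||||].
- exact: slides_tl.
- exact: slides0.
- by move=> *; exact: slidesD.
- by move=> *; exact: slidesZ.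
- by move=> y z _ hy _ hz; exact: slidesM hy hz.
Qed.

Lemma tl_ideal_annr m z x : (forall i, (i.+1 < m)%N -> tl i * z = 0) ->
  tl_ideal m x -> x * z = 0.
Proof.
move=> hz; elim => [i h||||].
- exact: hz.
- by rewrite mul0r.
- by move=> y t _ hy _ ht; rewrite mulrDl hy ht addr0.
- by move=> d y _ hy; rewrite -scalerAl hy scaler0.
- by move=> y t _ hy _ ht; rewrite -mulrA ht mulr0.
Qed.
Lemma tl_ideal_annl m z x : (forall i, (i.+1 < m)%N -> z * tl i = 0) ->
  tl_ideal m x -> z * x = 0.
Proof.
move=> hz; elim => [i h||||].
- exact: hz.
- by rewrite mulr0.
- by move=> y t _ hy _ ht; rewrite mulrDr hy ht addr0.
- by move=> d y _ hy; rewrite -scalerAr hy scaler0.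
- by move=> y t _ hy _ ht; rewrite mulrA hy mul0r.
Qed.

Lemma local_sh_comm m x y : local m m x -> x * sh m y = sh m y * x.
Proof. by move=> h; rewrite h. Qed.

(* [y] is [x] turned upside down while it slides along nested extrema. *)
Lemma cups_el_rot m x : tl_ideal m x ->
  (exists2 y, tl_ideal m y & cups_el m * x = cups_el m * sh m y) /\
  (exists2 y, tl_ideal m y & cups_el m * sh m x = cups_el m * y).
Proof.
elim => [i h||||].
- split; first by exists (tl (m - i.+2)); [apply: TLI_gen; lia|exact: cups_el_tl].
  exists (tl (m - i.+2)); first by apply: TLI_gen; lia.
  rewrite cups_el_tl; last lia.
  by rewrite (_ : m - (m - i.+2).+2 = i)%N //; lia.
- by split; exists 0; rewrite ?sh0 //; exact: TLI_zero.
- move=> y z _ [[y1 ? h1] [y2 ? h2]] _ [[z1 ? h3] [z2 ? h4]].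
  split; [exists (y1 + z1)|exists (y2 + z2)]; rewrite ?shD ?mulrDr ?h1 ?h2 ?h3 ?h4 //;
    exact: TLI_add.
- move=> d y _ [[y1 ? h1] [y2 ? h2]].
  split; [exists (d *: y1)|exists (d *: y2)]; rewrite ?shZ -?scalerAr ?h1 ?h2 //;
    exact: TLI_scale.
- move=> y z ty [[y1 ? h1] [y2 ? h2]] tz [[z1 ? h3] [z2 ? h4]].
  split; [exists (z1 * y1)|exists (z2 * y2)]; try exact: TLI_mul.
    rewrite mulrA h1 -mulrA -(local_sh_comm y1 (local_tl_ideal tz)) mulrA h3.
    by rewrite shM mulrA.
  rewrite shM mulrA h2 -mulrA (local_sh_comm _ (local_tl_ideal _)) // mulrA h4.
  by rewrite mulrA.
Qed.
Lemma caps_el_rot m x : tl_ideal m x ->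
  (exists2 y, tl_ideal m y & x * caps_el m = sh m y * caps_el m) /\
  (exists2 y, tl_ideal m y & sh m x * caps_el m = y * caps_el m).
Proof.
elim => [i h||||].
- split; first by exists (tl (m - i.+2)); [apply: TLI_gen; lia|exact: tl_caps_el].
  exists (tl (m - i.+2)); first by apply: TLI_gen; lia.
  rewrite tl_caps_el; last lia.
  by rewrite (_ : m - (m - i.+2).+2 = i)%N //; lia.
- by split; exists 0; rewrite ?sh0 //; exact: TLI_zero.
- move=> y z _ [[y1 ? h1] [y2 ? h2]] _ [[z1 ? h3] [z2 ? h4]].
  split; [exists (y1 + z1)|exists (y2 + z2)]; rewrite ?shD ?mulrDl ?h1 ?h2 ?h3 ?h4 //;
    exact: TLI_add.
- move=> d y _ [[y1 ? h1] [y2 ? h2]].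
  split; [exists (d *: y1)|exists (d *: y2)]; rewrite ?shZ -?scalerAl ?h1 ?h2 //;
    exact: TLI_scale.
- move=> y z ty [[y1 ? h1] [y2 ? h2]] tz [[z1 ? h3] [z2 ? h4]].
  split; [exists (z1 * y1)|exists (z2 * y2)]; try exact: TLI_mul.
    rewrite -mulrA h3 mulrA (local_sh_comm z1 (local_tl_ideal ty)) -mulrA h1.
    by rewrite shM mulrA.
  rewrite shM -mulrA h4 mulrA -(local_sh_comm _ (local_tl_ideal _)) // -mulrA h2.
  by rewrite mulrA.
Qed.

(* The case [P = 0] covers the junk value of [jones_wenzl]. *)
Definition jw_like m P := [/\ P = 0 \/ exists2 x, tl_ideal m x & P = 1 + x,
  forall i, (i.+1 < m)%N -> tl i * P = 0 &
  forall i, (i.+1 < m)%N -> P * tl i = 0].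

Section JonesWenzl.
Variables (m : nat) (P : E) (jwP : jw_like m P).

Lemma local_jw : local m m P.
Proof.
case: jwP => -[->|[x hx ->]] _ _; first exact: local0.
by apply: localD; [exact: local1|exact: local_tl_ideal].
Qed.
Lemma slides_jw : slides m m P.
Proof.
case: jwP => -[->|[x hx ->]] _ _; first exact: slides0.
by apply: slidesD; [exact: slides1|exact: slides_tl_ideal].
Qed.
Lemma jw_idem : P * P = P.
Proof.
case: jwP => -[->|[x hx eP]] _ h; first by rewrite mul0r.
by rewrite [X in _ * X]eP mulrDr (tl_ideal_annl h hx) mulr1 addr0.
Qed.

(* Write [P = 1 + x].  Sliding [x] to the right block turns it into an element
   that the projector there kills, so a projector on the left may be dropped
   when there is one on the right; by symmetry also the other way round. *)
Lemma cups_el_jw : cups_el m * P = cups_el m * sh m P.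
Proof.
case: jwP => -[->|[x hx eP]] h1 h2; first by rewrite sh0.
have [[y hy ey] [z hz ez]] := cups_el_rot hx.
have e1 : cups_el m * P * sh m P = cups_el m * sh m P.
  rewrite [X in _ * X * _]eP mulrDr mulr1 ey mulrDl -mulrA -shM.
  by rewrite (tl_ideal_annr h1 hy) sh0 mulr0 addr0.
have e2 : cups_el m * sh m P * P = cups_el m * P.
  rewrite [X in _ * sh m X * _]eP shD sh1 mulrDr mulr1 ez mulrDl -mulrA.
  by rewrite (tl_ideal_annr h1 hz) mulr0 addr0.
by rewrite -e2 -mulrA -(local_sh_comm _ local_jw) mulrA e1.
Qed.
Lemma jw_caps_el : P * caps_el m = sh m P * caps_el m.
Proof.
case: jwP => -[->|[x hx eP]] h1 h2; first by rewrite sh0.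
have [[y hy ey] [z hz ez]] := caps_el_rot hx.
have e1 : sh m P * (P * caps_el m) = sh m P * caps_el m.
  rewrite [X in _ * (X * _)]eP mulrDl mul1r ey mulrDr mulrA -shM.
  by rewrite (tl_ideal_annl h2 hy) sh0 mul0r addr0.
have e2 : P * (sh m P * caps_el m) = P * caps_el m.
  rewrite [X in _ * (sh m X * _)]eP shD sh1 mulrDl mul1r ez mulrDr mulrA.
  by rewrite (tl_ideal_annl h2 hz) mul0r addr0.
by rewrite -e2 mulrA (local_sh_comm _ local_jw) -mulrA e1.
Qed.

End JonesWenzl.

End SkeinAlgebra.

Arguments sh : simpl never.
Arguments cup : simpl never.
Arguments cap : simpl never.

(** * Cabled diagrams *)

Section Cabling.
Variables (K : fieldType) (a : K) (E : skein_model a).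
Variables (m : nat) (P : E) (jwP : jw_like m P).
Implicit Types (x y z : E) (b c : bool) (i j k : nat) (w : word).

Let jw_local := local_jw jwP.
Let jw_slides := slides_jw jwP.
Let jwK := jw_idem jwP.

(** The projector on one leg is carried to the other leg, where idempotence merges the two. *)
Lemma cups_el_jw2 : cups_el E m * P * sh m P = cups_el E m * P.
Proof. by rewrite (cups_el_jw jwP) -mulrA -shM jwK. Qed.

Lemma jw2_caps_el : P * sh m P * caps_el E m = P * caps_el E m.
Proof. by rewrite -mulrA -(jw_caps_el jwP) mulrA jwK. Qed.

Lemma jw2_grid b : P * sh m P * grid E b 0 m m = grid E b 0 m m * (P * sh m P).
Proof.
rewrite -mulrA jw_slides mulrA (slides_left jw_slides) -mulrA.
by rewrite (local_sh_comm _ jw_local).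
Qed.

(** The projector is doubled, so that hooks are killed on both blocks of legs as [cups_el_twist]
    demands, and merged again afterwards. *)
Lemma cups_el_jw_twist b :
  cups_el E m * P * grid E b 0 m m = twist a b m *: (cups_el E m * P).
Proof.
rewrite -{1}cups_el_jw2 -(mulrA (cups_el E m)) -mulrA jw2_grid mulrA.
have [_ h _] := jwP; rewrite cups_el_twist.
- by rewrite mulrA cups_el_jw2.
- by move=> j lt_jm; rewrite mulrA h // mul0r.
- move=> j lt_jm; rewrite (local_sh_comm _ jw_local) mulrA -sh_tl -shM h //.
  by rewrite sh0 mul0r.
Qed.

Lemma jw_zigzagl : cups_el E m * P * sh m (caps_el E m) = P.
Proof. by rewrite -mulrA (local_sh_comm _ jw_local) mulrA cups_caps_el mul1r. Qed.

(** The left legs run into the maxima, so the projector is first moved to the right legs, which form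
    the outgoing strands. *)
Lemma jw_zigzagr : sh m (cups_el E m * P) * caps_el E m = P.
Proof.
rewrite (cups_el_jw jwP) shM sh_sh -mulrA -(local_caps_el m P) mulrA.
by rewrite sh_cups_caps_el mul1r.
Qed.

Definition cabled (l : letter) : E :=
  sh (m * l.2) (match l.1 with
    | Cup => cups_el E m | Cap => caps_el E m | Cross b => grid E b 0 m m end).

(* A projector above every minimum, instead of one for each component: this
   makes the invariance under the moves a local matter. *)
Definition decorated (l : letter) : E :=
  if l.1 is Cup then cabled l * sh (m * l.2) P else cabled l.

Definition decorate w : E := foldr (fun l x => decorated l * x) 1 w.

Lemma decorate_cat w w' : decorate (w ++ w') = decorate w * decorate w'.
Proof. by elim: w => [|l w ih] /=; rewrite ?mul1r // ih mulrA. Qed.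

Lemma sh_decorated j p i : sh (m * j) (decorated (p, i)) = decorated (p, (j + i)%N).
Proof. by case: p => [||b]; rewrite /decorated /cabled /= ?shM !sh_sh -!mulnDr. Qed.

Lemma sh_cabled j p i : sh (m * j) (cabled (p, i)) = cabled (p, (j + i)%N).
Proof. by rewrite /cabled sh_sh -mulnDr. Qed.

Lemma local_cabled0 p :
  local (m * arity_in p) (m * arity_out p) (cabled (p, 0%N)).
Proof.
case: p => [||b]; rewrite /cabled /= ?muln0 mulnC mul2n -addnn.
- exact: local_cups_el.
- exact: local_caps_el.
- exact: local_grid.
Qed.

Lemma cabled_far p i k y :
  cabled (p, i) * sh (m * (i + arity_out p + k)) y =
  sh (m * (i + arity_in p + k)) y * cabled (p, i).
Proof.
rewrite -[i]addn0 -(sh_cabled i p 0) addn0 -!addnA !(mulnDr m i) -!sh_sh -!shM.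
by congr (sh _ _); rewrite !mulnDr -!sh_sh local_cabled0.
Qed.

(** Says that the [n] cabled strands on top of [x] already carry projectors. Decorated words
    starting from no strands have this property. *)
Definition absorbs n x := forall j, (j < n)%N -> x * sh (m * j) P = x.

Lemma jw_sh_comm j i y : (j < i)%N ->
  sh (m * j) P * sh (m * i) y = sh (m * i) y * sh (m * j) P.
Proof.
move=> h; have -> : (m * i = m * j + (m + m * (i - j.+1)))%N.
  by rewrite -[(m + _)%N]mulnS -mulnDr; congr (_ * _)%N; lia.
by rewrite -!sh_sh -!shM (local_sh_comm _ jw_local).
Qed.

Lemma decorated_far p i k y :
  decorated (p, i) * sh (m * (i + arity_out p + k)) y =
  sh (m * (i + arity_in p + k)) y * decorated (p, i).
Proof.
case: p => [||b]; rewrite /decorated /=; [|exact: cabled_far..].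
by rewrite -mulrA jw_sh_comm ?mulrA ?(cabled_far Cup) //=; lia.
Qed.

Lemma cabled_jw_lt p i j : (j < i)%N ->
  cabled (p, i) * sh (m * j) P = sh (m * j) P * cabled (p, i).
Proof. by move=> h; rewrite -[i]addn0 -sh_cabled jw_sh_comm. Qed.

Lemma decorated_jw_lt p i j : (j < i)%N ->
  decorated (p, i) * sh (m * j) P = sh (m * j) P * decorated (p, i).
Proof. by move=> h; rewrite -[i]addn0 -sh_decorated jw_sh_comm. Qed.

Lemma jw_grid0 b i : decorated (Cross b, i) * sh (m * i) P =
  sh (m * i.+1) P * decorated (Cross b, i).
Proof. by rewrite /decorated /cabled /= -!shM mulnSr -sh_sh -shM jw_slides. Qed.
Lemma jw_gridS b i : decorated (Cross b, i) * sh (m * i.+1) P =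
  sh (m * i) P * decorated (Cross b, i).
Proof.
rewrite /decorated /cabled /= mulnSr -sh_sh -!shM.
by rewrite (slides_left jw_slides).
Qed.

Lemma absorbs_step p i n x : (i + arity_in p <= n)%N -> absorbs n x ->
  absorbs (n - arity_in p + arity_out p) (x * decorated (p, i)).
Proof.
move=> le_in hx j lt_j; have [lt_ji|le_ij] := ltnP j i.
  by rewrite -mulrA decorated_jw_lt // mulrA hx //; lia.
have [h|h] := leqP (i + arity_out p) j.
  rewrite -{1}(subnKC h) -mulrA decorated_far mulrA hx //.
  by case: p le_in lt_j h => /=; lia.
case: p h le_in lt_j => [||b] /= h le_in lt_j; last 2 first.
- by move: h le_ij; rewrite addn0 ltnNge => /negP.
- have [->|->] : j = i \/ j = i.+1 by lia.
    by rewrite -mulrA jw_grid0 mulrA hx //; lia.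
  by rewrite -mulrA jw_gridS mulrA hx //; lia.
rewrite -mulrA; congr (_ * _); rewrite /decorated /cabled /=.
have [->|->] : j = i \/ j = i.+1 by lia.
  by rewrite -mulrA -shM jwK.
by rewrite mulnSr -sh_sh -!shM cups_el_jw2.
Qed.

Lemma absorbs_decorate w n n' x : target w n = Some n' -> absorbs n x ->
  absorbs n' (x * decorate w).
Proof.
elim: w n x => [|[p i] w ih] n x /=; first by case=> <-; rewrite mulr1.
case: ifP => // le_in tw hx; rewrite mulrA; apply: ih tw _.
exact: absorbs_step.
Qed.

Lemma cup_cross_cabled b i :
  cabled (Cup, i) * cabled (Cross b, i.+1) =
  cabled (Cup, i.+1) * cabled (Cross (~~ b), i).
Proof.
rewrite /cabled /= mulnSr -!sh_sh -!shM; congr (sh _ _).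
by rewrite sh_grid addn0 cups_el_grid.
Qed.
Lemma cross_cap_cabled b i :
  cabled (Cross b, i) * cabled (Cap, i.+1) =
  cabled (Cross (~~ b), i.+1) * cabled (Cap, i).
Proof.
rewrite /cabled /= mulnSr -!sh_sh -!shM; congr (sh _ _).
by rewrite sh_grid addn0 grid_caps_el.
Qed.

Lemma decorated_zigzagl i :
  decorated (Cup, i) * decorated (Cap, i.+1) = sh (m * i) P.
Proof. by rewrite /decorated /cabled /= mulnSr -!sh_sh -!shM jw_zigzagl. Qed.
Lemma decorated_zigzagr i :
  decorated (Cup, i.+1) * decorated (Cap, i) = sh (m * i) P.
Proof.
by rewrite /decorated /cabled /= -shM mulnSr -!sh_sh -!shM jw_zigzagr.
Qed.

Lemma decorated_cup_twist b i :
  decorated (Cup, i) * decorated (Cross b, i) = twist a b m *: decorated (Cup, i).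
Proof.
by rewrite /decorated /cabled /= -!shM cups_el_jw_twist // shZ.
Qed.

(** On both sides the projector can be lifted above the crossing, and in both cases it arrives on
    strand [i]. *)
Lemma cup_cross_decorated b i :
  decorated (Cup, i) * decorated (Cross b, i.+1) =
  decorated (Cup, i.+1) * decorated (Cross (~~ b), i).
Proof.
rewrite {1 3}/decorated /= -!mulrA -jw_grid0 -decorated_jw_lt // !mulrA.
by congr (_ * _); exact: cup_cross_cabled.
Qed.

Lemma decorate_planar u v n n' x : planar_move u v ->
  target u n = Some n' -> absorbs n x -> x * decorate u = x * decorate v.
Proof.
case=> [p q i k _ _|i t hx|i t hx|b i _ _|b i _ _]; rewrite /= !mulr1.
- have e j : decorated (q, (j + k)%N) = sh (m * (j + k)) (decorated (q, 0%N)).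
    by rewrite sh_decorated addn0.
  by rewrite !e decorated_far.
- by rewrite decorated_zigzagl hx //; move: t => /=; case: ifP => // h1; case: ifP => // h2 _; lia.
- by rewrite decorated_zigzagr hx //; move: t => /=; case: ifP => // h1; case: ifP => // h2 _; lia.
- by rewrite cup_cross_decorated.
- by rewrite [_ * decorated (Cap, _)]cross_cap_cabled.
Qed.

Lemma cross_cabledK b i : cabled (Cross b, i) * cabled (Cross (~~ b), i) = 1.
Proof. by rewrite -shM gridK sh1. Qed.

(** Two consecutive cabled crossings of kind [b] form one grid of [m] by [m + m] strands, which
    slides across the crossing of kind [c]. *)
Lemma cross_cabled3l b c i :
  cabled (Cross b, i) * cabled (Cross b, i.+1) * cabled (Cross c, i) =
  cabled (Cross c, i.+1) * cabled (Cross b, i) * cabled (Cross b, i.+1).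
Proof.
rewrite /cabled /= mulnSr -!sh_sh -!shM; congr (sh _ _).
have h : slides (m + m) (m + m) (grid E c 0 m m) by exact: slides_grid.
by have := h b m; rewrite grid_addr !sh_grid !addn0 add0n mulrA => ->.
Qed.

(** The two sides are inverse to the two sides of [cross_cabled3l] for the opposite crossings. *)
Lemma cross_cabled3r b c i :
  cabled (Cross c, i) * cabled (Cross b, i.+1) * cabled (Cross b, i) =
  cabled (Cross b, i.+1) * cabled (Cross b, i) * cabled (Cross c, i.+1).
Proof.
have h := cross_cabled3l (~~ b) (~~ c) i.
have K1 d j t : cabled (Cross d, j) * (cabled (Cross (~~ d), j) * t) = t.
  by rewrite mulrA cross_cabledK mul1r.
have K2 d j t : cabled (Cross (~~ d), j) * (cabled (Cross d, j) * t) = t.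
  by rewrite -{2}(negbK d) K1.
set x := LHS; set y := RHS.
set z := cabled (Cross (~~ b), i) * cabled (Cross (~~ b), i.+1) *
  cabled (Cross (~~ c), i) in h; set z' := (X in _ = X) in h.
have yz : z * y = 1.
  by rewrite h -[z' * y]mulr1 /z' /y -!mulrA !K2.
have xz : x * z = 1 by rewrite -[x * z]mulr1 /x /z -!mulrA !K1.
by rewrite -[x]mulr1 -yz mulrA xz mul1r.
Qed.

Lemma decorate_rm2 b i :
  decorate [:: (Cross b, i); (Cross (~~ b), i)] = 1.
Proof. by rewrite /= mulr1 [LHS]cross_cabledK. Qed.

Lemma decorate_rm3 b b' b'' i : (b = b'' -> b' = b) ->
  decorate [:: (Cross b, i); (Cross b', i.+1); (Cross b'', i)] =
  decorate [:: (Cross b'', i.+1); (Cross b', i); (Cross b, i.+1)].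
Proof.
move=> h; rewrite /= !mulr1 !mulrA /decorated /=.
(* Excluding cyclic configurations means that the middle crossing agrees with one of the other
   two. *)
have [->|->] : b' = b \/ b' = b''.
- by case: b b' b'' h => -[] [] h; auto; have := h erefl.
- exact: cross_cabled3l.
- exact: cross_cabled3r.
Qed.

(** The crossing is turned around the maximum until it stands on the minimum, which changes its kind
    to [~~ b]. There remain a twist and a zigzag, whose projector [x] absorbs. *)
Lemma decorate_rm1_right b i n x : (i < n)%N -> absorbs n x ->
  x * decorate [:: (Cup, i.+1); (Cross b, i); (Cap, i.+1)] = twist a (~~ b) m *: x.
Proof.
move=> lt_in hx; rewrite /= mulr1 [_ * decorated (Cap, _)]cross_cap_cabled.
rewrite (mulrA (decorated _)) [_ * cabled (Cross _, _)]decorated_cup_twist.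
by rewrite -scalerAl [_ * cabled _]decorated_zigzagr -scalerAr hx.
Qed.

Lemma decorate_rm1_left b i n x : (i < n)%N -> absorbs n x ->
  x * decorate [:: (Cup, i); (Cross b, i.+1); (Cap, i)] = twist a (~~ b) m *: x.
Proof.
move=> lt_in hx; rewrite /= mulr1.
have := cross_cap_cabled (~~ b) i; rewrite negbK => h.
rewrite [decorated (Cross _, _) * _](esym h).
rewrite (mulrA (decorated _)) [_ * cabled (Cross _, _)]decorated_cup_twist.
by rewrite -scalerAl [_ * cabled _]decorated_zigzagl -scalerAr hx.
Qed.

(** * One projector per component against one per minimum *)

Fixpoint colored_el (l : seq nat) (w : word) : E :=
  if w is x :: w' then
    (if closes x l then sh (m * x.2) P else 1) *
    (cabled x * colored_el (label_step x l) w')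
  else 1.

Fixpoint jw_all n : E := if n is n'.+1 then P * sh m (jw_all n') else 1.

Lemma jw_all_add n n' : jw_all (n + n') = jw_all n * sh (m * n) (jw_all n').
Proof.
elim: n => [|n ih] /=; first by rewrite muln0 mul1r.
by rewrite ih shM sh_sh mulrA mulnS.
Qed.

Lemma local_jw_all n : local (m * n) (m * n) (jw_all n).
Proof.
elim: n => [|n ih] /=; first exact: local1.
rewrite mulnS; apply: localM (local_sh m ih).
exact: local_widen.
Qed.

Lemma jw_all_absorb n j : (j < n)%N -> sh (m * j) P * jw_all n = jw_all n.
Proof.
elim: n j => [|n ih] [|j] //= lt_jn; first by rewrite muln0 /= mulrA jwK.
by rewrite mulnS -sh_sh mulrA -(local_sh_comm _ jw_local) -mulrA -shM ih.
Qed.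

(** A full row of projectors is pushed up through a letter. The projector of a minimum is doubled
    onto both legs; the two below a maximum merge into one that stays behind. *)
Lemma jw_all_letter (p : piece) i n : (i + arity_in p <= n)%N ->
  jw_all n * decorated (p, i) =
  (if p is Cap then sh (m * i) P else 1) *
  cabled (p, i) * jw_all (n - arity_in p + arity_out p).
Proof.
move=> h; pose r := (n - (i + arity_in p))%N.
have -> : n = (i + (arity_in p + r))%N by rewrite /r; lia.
have -> : (i + (arity_in p + r) - arity_in p + arity_out p =
  i + (arity_out p + r))%N by lia.
rewrite (jw_all_add i) -(addn0 i) -sh_decorated addn0 (jw_all_add i) -mulrA -shM.
set d := if p is Cap then _ else _.
suff e : jw_all (arity_in p + r) * decorated (p, 0%N) =
    (if p is Cap then P else 1) * cabled (p, 0%N) * jw_all (arity_out p + r).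
  rewrite e !shM !mulrA; congr (_ * _).
  have -> : cabled (p, i) = sh (m * i) (cabled (p, 0%N)).
    by rewrite /cabled /= muln0.
  have -> : d = sh (m * i) (if p is Cap then P else 1).
    by rewrite /d; case: (p) => *; rewrite ?sh1.
  by rewrite -mulrA -shM local_jw_all shM.
have := decorated_far p 0 0 (jw_all r); rewrite !addn0 !add0n => lr.
rewrite !jw_all_add -mulrA -lr !mulrA; congr (_ * _).
rewrite /decorated /cabled; case: (p) => [||b] /=; rewrite ?muln0 /= ?sh1 ?mulr1 ?mul1r.
- by rewrite mulrA cups_el_jw2.
- by rewrite jw2_caps_el.
- by rewrite jw2_grid.
Qed.

(** Strands with equal labels are connected below, and a projector can be carried along the
    connection from one endpoint to the other. *)
Definition labelled x (l : seq nat) := forall j k, (j < size l)%N ->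
  (k < size l)%N -> nth 0 l j = nth 0 l k :> nat ->
  x * sh (m * j) P = x * sh (m * k) P.

Lemma size_label_step (p : piece) i (l : seq nat) : (i + arity_in p <= size l)%N ->
  size (label_step (p, i) l) = (size l - arity_in p + arity_out p)%N.
Proof.
case: p => [||b] /= h; rewrite ?size_map !size_cat ?size_take ?size_drop /=;
  case: ltnP => h2 /=; try lia.
Qed.

Lemma label_step_cup (l : seq nat) i j : (i <= size l)%N ->
  nth 0 (label_step (Cup, i) l) j =
  if (j < i)%N then nth 0 l j else if (j < i.+2)%N then fresh l else nth 0 l (j - 2).
Proof.
move=> h; rewrite /label_step /= nth_cat size_takel //; case: ltnP => /= lt_ji.
  by rewrite nth_take.
rewrite -(subnKC lt_ji); move: (j - i)%N => k; rewrite addKn.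
case: k => [|[|k]]; [by rewrite /= ifT //; lia..|].
rewrite ifF; last lia.
by rewrite /= nth_drop (_ : i + k.+2 - 2 = i + k)%N //; lia.
Qed.

Lemma label_step_cross b (l : seq nat) i j : (i.+1 < size l)%N ->
  nth 0 (label_step (Cross b, i) l) j =
  nth 0 l (if j == i then i.+1 else if j == i.+1 then i else j).
Proof.
move=> h; rewrite /label_step /= nth_cat size_takel; last lia.
case: ltnP => /= lt_ji.
  by rewrite nth_take // !ifF //; lia.
rewrite -(subnKC lt_ji); move: (j - i)%N => k; rewrite addKn.
case: k => [|[|k]] /=.
- by rewrite addn0 eqxx.
- by rewrite addn1 eqxx ifF //; lia.
- by rewrite !ifF ?nth_drop ?addnS //; lia.
Qed.

Lemma label_step_cap (l : seq nat) i j : (i.+1 < size l)%N ->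
  (j < size l - 2)%N ->
  nth 0 (label_step (Cap, i) l) j =
  let z := nth 0 l (if (j < i)%N then j else j.+2) in
  if z == nth 0 l i.+1 then nth 0 l i else z.
Proof.
move=> h lt_j; have sz : size (take i l ++ drop i.+2 l) = (size l - 2)%N.
  by rewrite size_cat size_takel ?size_drop; lia.
rewrite /label_step /= (nth_map 0) ?sz // nth_cat size_takel; last exact: ltnW (ltnW h).
case: ltnP => /= lt_ji; first by rewrite nth_take.
by rewrite nth_drop (_ : i.+2 + (j - i) = j.+2)%N //; lia.
Qed.

Lemma fresh_notin (l : seq nat) : fresh l \notin l.
Proof.
apply/negP => h.
suff : (fresh l <= foldr maxn 0 l)%N by rewrite ltnn.
by elim: l (fresh l) h => //= y l ih z; rewrite inE leq_max => /orP[/eqP->|/ih->];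
  rewrite ?leqnn ?orbT.
Qed.

Lemma jw_sh_jw j k :
  sh (m * j) P * sh (m * k) P = sh (m * k) P * sh (m * j) P.
Proof. by have [/jw_sh_comm->|/jw_sh_comm->|->] := ltngtP j k. Qed.

Lemma cabled_jw_ge p i j : (i + arity_out p <= j)%N ->
  cabled (p, i) * sh (m * j) P =
  sh (m * (j - arity_out p + arity_in p)) P * cabled (p, i).
Proof.
move=> h; rewrite -{1}(subnKC h) cabled_far; congr (sh (m * _) _ * _); lia.
Qed.

Lemma cup_jw0 i : cabled (Cup, i) * sh (m * i) P = cabled (Cup, i) * sh (m * i.+1) P.
Proof. by rewrite /cabled /= mulnSr -sh_sh -!shM (cups_el_jw jwP). Qed.
Lemma jw_cap0 i : sh (m * i) P * cabled (Cap, i) = sh (m * i.+1) P * cabled (Cap, i).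
Proof. by rewrite /cabled /= mulnSr -sh_sh -!shM (jw_caps_el jwP). Qed.

Lemma labelled_cup i (l : seq nat) x : (i <= size l)%N -> labelled x l ->
  labelled (x * cabled (Cup, i)) (label_step (Cup, i) l).
Proof.
move=> le_i lx j k; rewrite size_label_step /= ?addn0 // subn0 => lt_j lt_k.
rewrite !label_step_cup // -!mulrA.
have step j0 : ~~ (i <= j0 < i.+2)%N -> cabled (Cup, i) * sh (m * j0) P =
    sh (m * (if (j0 < i)%N then j0 else (j0 - 2)%N)) P * cabled (Cup, i).
  move=> h; case: ifP => lt_j0; first by rewrite cabled_jw_lt.
  by rewrite cabled_jw_ge /= ?addn0 //; lia.
have new j0 : (i <= j0 < i.+2)%N ->
    cabled (Cup, i) * sh (m * j0) P = cabled (Cup, i) * sh (m * i) P.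
  by move=> h; have [->|->] : j0 = i \/ j0 = i.+1; rewrite // ?cup_jw0 //; lia.
have old j0 : (j0 < size l + 2)%N -> ~~ (i <= j0 < i.+2)%N ->
    ((if (j0 < i)%N then j0 else (j0 - 2)%N) < size l)%N.
  by move=> ? ?; case: ifP; lia.
have nthE j0 : ~~ (i <= j0 < i.+2)%N ->
    (if (j0 < i)%N then nth 0 l j0 else if (j0 < i.+2)%N then fresh l
     else nth 0 l (j0 - 2)) = nth 0 l (if (j0 < i)%N then j0 else (j0 - 2)%N).
  by move=> h; case: ifP => // ?; rewrite ifF //; lia.
have nthN j0 : (i <= j0 < i.+2)%N ->
    (if (j0 < i)%N then nth 0 l j0 else if (j0 < i.+2)%N then fresh l
     else nth 0 l (j0 - 2)) = fresh l.
  by move=> h; rewrite ifF ?ifT //; lia.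
case: (boolP (i <= j < i.+2)%N) => hj; case: (boolP (i <= k < i.+2)%N) => hk.
- by rewrite !new.
- by rewrite nthN // nthE // => e; have := fresh_notin l; rewrite e mem_nth ?old.
- by rewrite nthE // nthN // => e; have := fresh_notin l; rewrite -e mem_nth ?old.
- by rewrite !nthE // !step // !mulrA => /lx ->; rewrite ?old.
Qed.

Lemma labelled_cross b i (l : seq nat) x : (i.+1 < size l)%N -> labelled x l ->
  labelled (x * cabled (Cross b, i)) (label_step (Cross b, i) l).
Proof.
move=> le_i lx j k; rewrite size_label_step /= ?addn2 // subn2 => lt_j lt_k.
rewrite !label_step_cross // -!mulrA.
have step j0 : cabled (Cross b, i) * sh (m * j0) P =
    sh (m * (if j0 == i then i.+1 else if j0 == i.+1 then i else j0)) P *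
    cabled (Cross b, i).
  case: eqP => [->|?]; first exact: jw_grid0.
  case: eqP => [->|?]; first exact: jw_gridS.
  have [lt_j0|le_j0] := ltnP j0 i; first by rewrite cabled_jw_lt.
  by rewrite cabled_jw_ge /=; [congr (sh (m * _) _ * _)|]; lia.
rewrite !step !mulrA => /lx ->//; case: eqP => [|_]; try lia;
  by case: eqP => [|_]; lia.
Qed.

Lemma labelled_cap i (l : seq nat) x : (i.+1 < size l)%N -> labelled x l ->
  labelled (x * ((if closes (Cap, i) l then sh (m * i) P else 1) * cabled (Cap, i)))
    (label_step (Cap, i) l).
Proof.
move=> le_i lx j k; rewrite size_label_step /= ?addn2 // addn0 => lt_j lt_k.
rewrite !label_step_cap //=.
set e : E := if closes (Cap, i) l then _ else _.
pose f j0 := if (j0 < i)%N then j0 else j0.+2.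
have step j0 : e * cabled (Cap, i) * sh (m * j0) P =
    sh (m * f j0) P * (e * cabled (Cap, i)).
  have -> : sh (m * f j0) P * (e * cabled (Cap, i)) =
      e * (sh (m * f j0) P * cabled (Cap, i)).
    by rewrite /e; case: ifP; rewrite ?mul1r // !mulrA jw_sh_jw.
  rewrite -mulrA; congr (_ * _); rewrite /f; case: ifP => h.
    by rewrite cabled_jw_lt.
  by rewrite cabled_jw_ge /= ?subn0 ?addn2 //; lia.
have ltf j0 : (j0 < size l - 2)%N -> (f j0 < size l)%N.
  by rewrite /f => ?; case: ifP; lia.
have {lt_j}lt_j := ltf _ lt_j; have {lt_k}lt_k := ltf _ lt_k.
rewrite -!(mulrA x) !step !mulrA -/(f j) -/(f k).
move: (f j) (f k) lt_j lt_k => {}j {}k lt_j lt_k.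
(* Two components become one: the projector goes from [j0] to strand [i], over the maximum to strand
   [i.+1], and on to [k0]. *)
have key j0 k0 : (j0 < size l)%N -> (k0 < size l)%N ->
    nth 0 l j0 = nth 0 l i -> nth 0 l k0 = nth 0 l i.+1 ->
    nth 0 l i != nth 0 l i.+1 ->
    x * sh (m * j0) P * e * cabled (Cap, i) = x * sh (m * k0) P * e * cabled (Cap, i).
  move=> lt_j0 lt_k0 ej ek /negPf ne.
  have -> : e = 1 by rewrite /e /closes /= ne.
  rewrite !mulr1 (lx j0 i) // ?(lx k0 i.+1) //; last by lia.
  by rewrite -!mulrA jw_cap0.
case: (eqVneq (nth 0 l j) (nth 0 l i.+1)) => ej;
  case: (eqVneq (nth 0 l k) (nth 0 l i.+1)) => ek.
- by move=> _; rewrite (lx j k) // ej.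
- case: (eqVneq (nth 0 l i) (nth 0 l i.+1)) => [e1 e2|ne e2].
    by rewrite -e2 e1 eqxx in ek.
  by apply/esym; exact: key.
- case: (eqVneq (nth 0 l i) (nth 0 l i.+1)) => [e1 e2|ne e2].
    by rewrite e2 e1 eqxx in ej.
  exact: key.
- by move=> h; rewrite (lx j k).
Qed.

Lemma labelled_step (p : piece) i (l : seq nat) x : (i + arity_in p <= size l)%N ->
  labelled x l ->
  labelled (x * ((if closes (p, i) l then sh (m * i) P else 1) * cabled (p, i)))
    (label_step (p, i) l).
Proof.
case: p => [||b] h lx.
- by rewrite mul1r; apply: labelled_cup => //; rewrite addn0 in h.
- by apply: labelled_cap => //; rewrite addn2 in h.
- by rewrite mul1r; apply: labelled_cross => //; rewrite addn2 in h.
Qed.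

Lemma count_merge (u v n : nat) (s : seq nat) :
  count_mem n [seq if k == v then u else k | k <- s] =
  if n == u then (count_mem u s + (u != v) * count_mem v s)%N
  else if n == v then 0%N else count_mem n s.
Proof.
elim: s => [|k s ih] /=; first by rewrite muln0 !if_same.
rewrite ih; case: (eqVneq k v) => [->|nzv].
  case: (eqVneq n u) => [_|nnu]; last by case: (eqVneq n v).
  by rewrite (eq_sym v); case: (u == v) => /=; rewrite ?mul0n ?mul1n; lia.
case: (eqVneq n u) => [->|nnu]; first by rewrite addnA.
by case: (eqVneq n v) => [->|//]; rewrite (negPf nzv).
Qed.

Lemma count_split2 i (l : seq nat) n : (i.+1 < size l)%N ->
  count_mem n l = (count_mem n (take i l) + ((nth 0 l i == n) +
    ((nth 0 l i.+1 == n) + count_mem n (drop i.+2 l))))%N.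
Proof.
move=> h; rewrite -{1}(cat_take_drop i l) count_cat.
by rewrite (drop_nth 0 (ltnW h)) (drop_nth 0 h).
Qed.

(* Below a given height each open component has two endpoints. *)
Definition paired (l : seq nat) := forall n, n \in l -> count_mem n l = 2%N.

Lemma paired_step (p : piece) i (l : seq nat) : (i + arity_in p <= size l)%N ->
  paired l -> paired (label_step (p, i) l).
Proof.
case: p => [||b] /= h pl n; rewrite /label_step /=.
- have cE k : count_mem k (take i l ++ drop i l) = count_mem k l.
    by rewrite cat_take_drop.
  rewrite !mem_cat !inE !count_cat /= => hn.
  have := cE n; rewrite count_cat => En.
  case: (eqVneq n (fresh l)) => [e|ne].
    have : count_mem n l = 0%N by rewrite e; apply/count_memPn; exact: fresh_notin.
    move=> c0; move: En; rewrite c0 => /eqP; rewrite addn_eq0.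
    by case/andP => /eqP-> /eqP->.
  rewrite /= !add0n En pl //.
  rewrite -(cat_take_drop i l) mem_cat; move: hn.
  by rewrite (negPf ne) /=.
- rewrite addn2 in h; rewrite -has_pred1 has_count count_merge !count_cat.
  set u := nth 0 l i; set v := nth 0 l i.+1.
  have : forall k, (0 < count_mem k l)%N -> count_mem k l = 2%N.
    by move=> k; rewrite -has_count has_pred1; exact: pl.
  pose c k := (count_mem k (take i l) + count_mem k (drop i.+2 l))%N.
  have cE k : count_mem k l = (c k + (u == k) + (v == k))%N.
    by rewrite (count_split2 _ h) /c -/u -/v; lia.
  rewrite -!/(c _) => pl'.
  have {}pl' k : (0 < c k + (u == k) + (v == k) -> c k + (u == k) + (v == k) = 2)%N.
    by rewrite -cE; exact: pl'.
  move: {cE} c pl' => c pl'.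
  have := pl' u; have := pl' v; have := pl' n; rewrite !eqxx (eq_sym v u).
  case: (eqVneq n u) => [->|nu].
    by case: (eqVneq u v) => [<-|uv]; rewrite ?eqxx ?mul0n ?mul1n; lia.
  by case: (eqVneq n v) => [->|nv] //; lia.
- rewrite addn2 in h.
  have e : count_mem n (label_step (Cross b, i) l) = count_mem n l.
    by rewrite count_cat (count_split2 n h); congr addn; exact: addnCA.
  by rewrite -has_pred1 has_count [count _ _]e -has_count has_pred1; move/pl; rewrite -e.
Qed.

Lemma paired_other i (l : seq nat) : (i < size l)%N -> paired l ->
  exists2 j, (j < size l)%N /\ j != i & nth 0 l j = nth 0 l i.
Proof.
move=> lt_il pl; have := pl _ (mem_nth 0 lt_il).
rewrite -{2}(cat_take_drop i l) count_cat (drop_nth 0 lt_il) /= eqxx => h.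
have : nth 0 l i \in take i l ++ drop i.+1 l.
  by rewrite -has_pred1 has_count count_cat; move: h; rewrite addnCA add1n => -[->].
rewrite mem_cat => /orP[] /(nthP 0)[j lt_j <-].
  rewrite size_take lt_il in lt_j.
  exists j; last by rewrite nth_take.
  by rewrite (ltn_trans lt_j lt_il) (ltn_eqF lt_j).
rewrite size_drop in lt_j.
exists (i.+1 + j)%N; last by rewrite nth_drop.
by rewrite -ltn_subRL lt_j gtn_eqF ?leq_addr.
Qed.

(** Pushing the row of projectors through the whole word leaves one below each maximum. It is kept
    where a component closes, as in the colored diagram, and must be removed at all other maxima. *)
Lemma colored_el_decorate w (l : seq nat) x : labelled x l -> paired l ->
  target w (size l) = Some 0 ->
  x * jw_all (size l) * decorate w = x * colored_el l w.
Proof.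
elim: w l x => [|[p i] w ih] l x lx pl; first by case=> ->; rewrite /= mulr1.
rewrite [target _ _]/=; case: ifP => // le_in tw.
have := ih _ _ (labelled_step le_in lx) (paired_step le_in pl).
rewrite size_label_step // => /(_ tw); rewrite /= -!mulrA => <-.
rewrite (mulrA (jw_all _)) jw_all_letter // -!mulrA.
case: p le_in tw => [||b] //= le_in _; case: ifP => // /negP ncl.
have lt_il : (i < size l)%N by lia.
(* The maximum does not close its component, so strand [i] has a partner [j] outside the maximum.
   The projector is carried there, lifted past the maximum, and merges into the row above. *)
have [j [lt_j ne_ji] eq_ji] := paired_other lt_il pl.
have ne_jiS : j != i.+1 by apply/eqP => e; apply: ncl; rewrite /closes /= -eq_ji e.
rewrite mulrA (lx i j) // mul1r -mulrA; congr (_ * _); rewrite !mulrA; congr (_ * _).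
have [lt_ji|le_ij] := ltnP j i.
  by rewrite -cabled_jw_lt // -mulrA jw_all_absorb //; lia.
have -> : j = (j - 2 - arity_out Cap + arity_in Cap)%N by rewrite /=; lia.
rewrite -cabled_jw_ge /=; last lia.
by rewrite -mulrA jw_all_absorb //; lia.
Qed.

End Cabling.

(** * Skeins in a model, and the bracket *)

Section Evaluation.
Variables (E : skein_model A).
Implicit Types (w : word) (f g : comb).

Definition ev_letter (l : letter) : E :=
  match l.1 with Cup => cup E l.2 | Cap => cap E l.2 | Cross b => crossing E b l.2 end.
Definition ev_word w : E := foldr (fun l x => ev_letter l * x) 1 w.
Definition ev f : E := foldr (fun t x => t.1 *: ev_word t.2 + x) 0 f.

Lemma ev_word_cat w w' : ev_word (w ++ w') = ev_word w * ev_word w'.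
Proof. by elim: w => [|l w ih] /=; rewrite ?mul1r // ih mulrA. Qed.
Lemma ev_word_cons l w : ev_word (l :: w) = ev_letter l * ev_word w.
Proof. by []. Qed.

Lemma ev_word_shift k w : ev_word (shift k w) = sh k (ev_word w).
Proof.
elim: w => [|[p i] w ih] /=; rewrite ?sh1 // shM -ih; congr (_ * _).
by case: p => [||b]; rewrite /ev_letter /= ?sh_cup ?sh_cap ?sh_crossing addnC.
Qed.

Lemma ev_cat f g : ev (f ++ g) = ev f + ev g.
Proof. by elim: f => [|t f ih] /=; rewrite ?add0r // ih addrA. Qed.
Lemma ev1 c w : ev [:: (c, w)] = c *: ev_word w.
Proof. exact: addr0. Qed.
Lemma ev_comb_of w : ev (comb_of w) = ev_word w.
Proof. by rewrite ev1 scale1r. Qed.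
Lemma ev_scale c f : ev (comb_scale c f) = c *: ev f.
Proof. by elim: f => [|t f ih] /=; rewrite ?scaler0 // ih scalerDr scalerA. Qed.
Lemma ev_stack f g : ev (comb_stack f g) = ev f * ev g.
Proof.
elim: f => [|t f ih]; first by rewrite mul0r.
rewrite /comb_stack allpairs_cons ev_cat [X in _ + X]ih /= mulrDl; congr (_ + _).
elim: g {ih} => [|s g ih] /=; first by rewrite mulr0.
rewrite ih mulrDr ev_word_cat; congr (_ + _).
by rewrite -scalerAl -scalerAr scalerA.
Qed.
Lemma ev_shift k f : ev (comb_shift k f) = sh k (ev f).
Proof.
by elim: f => [|t f ih] /=; rewrite ?sh0 // shD shZ ih ev_word_shift.
Qed.

Lemma ev_letter_shift k p i : ev_letter (p, (k + i)%N) = sh k (ev_letter (p, i)).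
Proof. by case: p => [||b]; rewrite /ev_letter /= ?sh_cup ?sh_cap ?sh_crossing. Qed.

Lemma local_ev_letter p i :
  local (i + arity_in p) (i + arity_out p) (ev_letter (p, i)).
Proof.
rewrite -{3}[i]addn0 ev_letter_shift; apply: local_sh.
by case: p => [||b]; [exact: local_cup|exact: local_cap|exact: local_crossing].
Qed.

Lemma ev_planar u v : planar_move u v -> ev_word u = ev_word v.
Proof.
case=> [p q i k|i|i|b i|b i]; rewrite /= !mulr1.
- rewrite -[k]addn0 !addnA !ev_letter_shift.
  exact: local_widen (local_ev_letter p i) _.
- exact: cup_capS.
- exact: cupS_cap.
- by rewrite /ev_letter /= cup_crossingS cupS_crossing negbK addrC.
- by rewrite /ev_letter /= crossing_capS crossingS_cap negbK addrC.
Qed.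

Lemma ev_resolution b s i :
  ev_word (resolution b s i) = if b == s then 1 else tl E i.
Proof. by rewrite /resolution; case: ifP => //= _; rewrite mulr1. Qed.

Lemma ev_skein_eq n n' f g : skein_eq n n' f g -> ev f = ev g.
Proof.
elim=> {f g}; rewrite ?ev_cat.
- by [].
- by [].
- by move=> f g h _ -> _ ->.
- by move=> f f' g g' _ h1 _ h2; rewrite !ev_cat h1 h2.
- by move=> f g; rewrite !ev_cat addrC.
- by move=> c d w; rewrite /= !addr0 scalerDl.
- by move=> w; rewrite ev1 scale0r.
- by move=> c x u v y h _ _; rewrite !ev1 !ev_word_cat (ev_planar h).
- move=> c x s i y _; rewrite /= !addr0 !ev_word_cat /= !ev_resolution.
  rewrite /ev_letter /crossing /=.
  by case: s; rewrite /= !mulrDl !mulrDr -!scalerAl -!scalerAr !scalerDr !scalerA //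
    addrC.
- move=> c x i y _; rewrite !ev1 !ev_word_cat /= mulr1 /ev_letter /= cup_cap.
  by rewrite -!scalerAl -scalerAr mul1r scalerA.
Qed.

End Evaluation.

(** * Arities, and reduction of closed words to scalars *)

Lemma target_cat w w' n : target (w ++ w') n = obind (target w') (target w n).
Proof. by elim: w n => //= [[p i] w ih] n; case: ifP. Qed.

Lemma target_shift k r w n n' : target w n = Some n' ->
  target (shift k w) (k + n + r) = Some (k + n' + r)%N.
Proof.
elim: w n => [|[p i] w ih] n /=; first by case=> ->.
case: ifP => // h /ih <-; rewrite ifT; last lia.
by congr target; lia.
Qed.

Lemma iota_rcons n : iota 0 n.+1 = rcons (iota 0 n) n.
Proof. by rewrite -addn1 iotaD cats1. Qed.

Lemma cups_rcons n i : cups n.+1 i = rcons (cups n i) (Cup, (i + n)%N).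
Proof. by rewrite /cups iota_rcons map_rcons. Qed.
Lemma caps_cons n i : caps n.+1 i = (Cap, (i + n)%N) :: caps n i.
Proof. by rewrite /caps iota_rcons rev_rcons. Qed.

Lemma target_cups n i k : (i <= k)%N -> target (cups n i) k = Some (k + n + n)%N.
Proof.
move=> h; elim: n => [|n ih]; first by rewrite !addn0.
rewrite cups_rcons -cats1 target_cat ih /= ifT; last lia.
by congr Some; lia.
Qed.
Lemma target_caps n i k : (i + n + n <= k)%N -> target (caps n i) k = Some (k - n - n)%N.
Proof.
elim: n k => [|n ih] k h; first by rewrite !subn0.
rewrite caps_cons /= ifT; last lia.
by rewrite ih; [congr Some|]; lia.
Qed.

Lemma target_crossings w n :
  (forall l, l \in w -> exists b i, l = (Cross b, i) /\ (i.+1 < n)%N) ->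
  target w n = Some n.
Proof.
elim: w => //= -[p i] w ih h.
have [b [j [[-> ->] lt_j]]] := h _ (mem_head _ _).
rewrite addn2 lt_j subnK; last exact: leq_trans lt_j.
by apply: ih => l lw; apply: h; rewrite inE lw orbT.
Qed.

Lemma target_cable m p i n : (i + arity_in p <= n)%N ->
  target (cable_letter m (p, i)) (m * n) = Some (m * (n - arity_in p + arity_out p))%N.
Proof.
move=> h; case: p h => [||b] /= h.
- rewrite /cable_letter /= target_cups ?leq_mul2l; last lia.
  by congr Some; rewrite mulnDr subn0; lia.
- have hm : (m * (i + 2) <= m * n)%N by rewrite leq_mul2l h orbT.
  rewrite /cable_letter /= target_caps; last by move: hm; rewrite mulnDr; lia.
  by congr Some; rewrite addn0 mulnBr; lia.
- rewrite subnK; last lia.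
  have hm : (m * (i + 2) <= m * n)%N by rewrite leq_mul2l h orbT.
  apply: target_crossings => l /allpairsPdep[j [k [hj hk ->]]].
  exists b, (m * i + j + k)%N; split=> //.
  move: hj hk; rewrite mem_rev !mem_iota => hj hk.
  by move: hm; rewrite mulnDr; lia.
Qed.

Lemma comb_in_of n n' w : target w n = Some n' -> comb_in n n' (comb_of w).
Proof. by move=> h t; rewrite inE => /eqP ->. Qed.

Lemma comb_in_stack n n' n'' f g :
  comb_in n n' f -> comb_in n' n'' g -> comb_in n n'' (comb_stack f g).
Proof.
move=> hf hg t /allpairsPdep[x [y [hx hy ->]]].
by rewrite /tangle target_cat (hf _ hx) /= (hg _ hy).
Qed.

Lemma comb_in_shift k r n n' f :
  comb_in n n' f -> comb_in (k + n + r) (k + n' + r) (comb_shift k f).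
Proof. by move=> hf t /mapP[x hx ->]; apply: target_shift; exact: hf. Qed.

Lemma comb_in_colored m f l w n n' : comb_in m m f -> target w n = Some n' ->
  comb_in (m * n) (m * n') (colored_from m f l w).
Proof.
move=> hf; elim: w l n => [|[p i] w ih] l n /=.
  by case=> ->; exact: comb_in_of.
case: ifP => // le_in tw; apply: (@comb_in_stack _ (m * n)).
  case: p le_in {tw} => [||b] le_in; rewrite /closes /=; try exact: comb_in_of.
  case: eqP => // _; last exact: comb_in_of.
  have -> : (m * n = m * i + m + (m * (n - i.+1)))%N.
    rewrite -mulnSr -mulnDr; congr (_ * _)%N; move: le_in => /=; lia.
  exact: comb_in_shift.
apply: comb_in_stack (ih _ _ tw).
exact/comb_in_of/target_cable.
Qed.

Definition crosses (l : letter) : bool := if l.1 is Cross _ then true else false.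

(* Pushes the first maximum down until it meets the minimum below it. *)
Lemma skein_reduce_cap x i y :
  ~~ has crosses x -> ~~ has (fun l => l.1 == Cap) x -> ~~ has crosses y ->
  tangle 0 0 (x ++ (Cap, i) :: y) ->
  exists w d, [/\ (size w < size (x ++ (Cap, i) :: y))%N, ~~ has crosses w,
    tangle 0 0 w &
    forall c, skein_eq 0 0 [:: (c, x ++ (Cap, i) :: y)] [:: (c * d, w)]].
Proof.
elim/last_ind: x i y => [|x [p j] ih] i y.
  by rewrite /tangle /= addn2.
rewrite -cats1 !has_cat !negb_or.
case: p => [||b] //= /andP[cx _] /andP[px pc] cy //.
rewrite -catA /= => txy; have := txy; rewrite /tangle target_cat.
case tx: (target x 0) => [n|] //=; case: ifP => // le_jn; case: ifP => // le_in ty.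
have tC z : target z n = Some 0%N -> tangle 0 0 (x ++ z).
  by rewrite /tangle target_cat tx.
have red z d : target z n = Some 0%N ->
    (size z < (size y).+2)%N -> ~~ has crosses z ->
    (forall c, skein_eq 0 0 [:: (c, x ++ [:: (Cup, j), (Cap, i) & y])]
       [:: (c * d, x ++ z)]) ->
  exists w d, [/\ (size w < size (x ++ [:: (Cup, j), (Cap, i) & y]))%N,
    ~~ has crosses w, tangle 0 0 w &
    forall c, skein_eq 0 0 [:: (c, x ++ [:: (Cup, j), (Cap, i) & y])] [:: (c * d, w)]].
  move=> tz sz cz h; exists (x ++ z), d.
  split=> //; last exact: tC.
    by rewrite !size_cat ltn_add2l.
  by rewrite has_cat negb_or cx cz.
have eqn : (n - 0 + 2 - 2 + 0 = n)%N by lia.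
rewrite eqn in ty.
have [eij|ne_ij] := eqVneq i j.
  subst j; apply: (red y delta) => // c.
  exact: (SE_circle c txy).
have ziso u v : planar_move u v -> tangle 0 0 (x ++ u ++ y) -> tangle 0 0 (x ++ v ++ y) ->
    forall c, skein_eq 0 0 [:: (c, x ++ u ++ y)] [:: (c * 1, x ++ v ++ y)].
  by move=> *; rewrite mulr1; exact: SE_isotopy.
have [eij|ne_ij1] := eqVneq i j.+1.
  subst i; apply: (red y 1) => // c.
  apply: (ziso [:: (Cup, j); (Cap, j.+1)] [::]) => //; last exact: tC.
  exact: PM_zigzag_left.
have [eij|ne_ij2] := eqVneq j i.+1.
  subst j; apply: (red y 1) => // c.
  apply: (ziso [:: (Cup, i.+1); (Cap, i)] [::]) => //; last exact: tC.
  exact: PM_zigzag_right.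
have exch i' j' : planar_move [:: (Cup, j); (Cap, i)] [:: (Cap, i'); (Cup, j')] \/
     planar_move [:: (Cap, i'); (Cup, j')] [:: (Cup, j); (Cap, i)] ->
    tangle 0 0 (x ++ [:: (Cap, i'), (Cup, j') & y]) ->
  exists w d, [/\ (size w < size (x ++ [:: (Cup, j), (Cap, i) & y]))%N,
    ~~ has crosses w, tangle 0 0 w &
    forall c, skein_eq 0 0 [:: (c, x ++ [:: (Cup, j), (Cap, i) & y])] [:: (c * d, w)]].
  move=> mv t'; have [w [d [sw cw tw hw]]] := ih i' ((Cup, j') :: y) cx px cy t'.
  exists w, d; split=> // [|c]; first by move: sw; rewrite !size_cat.
  apply: SE_trans (hw c); case: mv => mv.
    exact: (SE_isotopy c mv txy t').
  by apply: SE_sym; exact: (SE_isotopy c mv t' txy).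
have [lt_ij|lt_ji] : (i.+2 <= j)%N \/ (j.+2 <= i)%N by lia.
  apply: (exch i (j - 2)%N).
    right; have := PM_exchange Cap Cup i (j - 2 - i).
    rewrite /= addn0 (_ : i + (j - 2 - i) = j - 2)%N; last lia.
    by rewrite (_ : i + 2 + (j - 2 - i) = j)%N //; lia.
  apply: tC => /=; rewrite !ifT; [|lia..].
  by rewrite -ty; congr target; lia.
apply: (exch (i - 2)%N j).
  left; have := PM_exchange Cup Cap j (i - 2 - j).
  rewrite /= addn0 (_ : j + (i - 2 - j) = i - 2)%N; last lia.
  by rewrite (_ : j + 2 + (i - 2 - j) = i)%N //; lia.
apply: tC => /=; rewrite !ifT; [|lia..].
by rewrite -ty; congr target; lia.
Qed.

Lemma target_cups_only w n n' : ~~ has crosses w -> ~~ has (fun l => l.1 == Cap) w ->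
  target w n = Some n' -> n' = (n + (size w).*2)%N.
Proof.
elim: w n => [|[p i] w ih] n /=; first by move=> _ _ [->]; rewrite addn0.
case: p => [||b] //= cw pw; case: ifP => // _ /(ih _ cw pw) ->; lia.
Qed.

(** A single [d] serves all coefficients [c], so reductions compose. Once no maximum is left the
    closed word is empty, because minima only add strands. *)
Lemma skein_reduce_planar w : ~~ has crosses w -> tangle 0 0 w ->
  exists d, forall c, skein_eq 0 0 [:: (c, w)] [:: (c * d, [::])].
Proof.
have [n] := ubnP (size w); elim: n w => // n ih w; rewrite ltnS => sw cw tw.
have [pw|pw] := boolP (has (fun l => l.1 == Cap) w); last first.
  have := target_cups_only cw pw tw; case: w {sw cw tw pw} => //= _.
  by exists 1 => c; rewrite mulr1; exact: SE_refl.
case/split_find: pw cw tw sw => -[p i] x y /= /eqP -> px.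
rewrite cat_rcons has_cat /= negb_or => /andP[cx cy] tw sw.
have [w' [d [sw' cw' tw' hw']]] := skein_reduce_cap cx px cy tw.
have [|d' hd'] := ih w' _ cw' tw'; first exact: leq_trans sw' sw.
by exists (d * d') => c; rewrite mulrA; apply: SE_trans (hw' c) (hd' _).
Qed.

Lemma skein_reduce_word w : tangle 0 0 w ->
  exists d, forall c, skein_eq 0 0 [:: (c, w)] [:: (c * d, [::])].
Proof.
have [n] := ubnP (count crosses w); elim: n w => // n ih w; rewrite ltnS => sw tw.
have [cw|cw] := boolP (has crosses w); last exact: skein_reduce_planar.
case/split_find: cw sw tw => -[[||s] i] x y //= _ _; rewrite cat_rcons => sw tw.
have tr b : tangle 0 0 (x ++ resolution b s i ++ y).
  move: tw; rewrite /tangle /resolution !target_cat.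
  case: (target x 0) => [m|] //=; case: ifP => // h; rewrite target_cat.
  rewrite subnK; last lia.
  case: ifP => _ //= ty; rewrite h ifT; last lia.
  by rewrite /= (_ : m - 2 + 0 - 0 + 2 = m)%N //; lia.
have sr b : (count crosses (x ++ resolution b s i ++ y) < n)%N.
  by move: sw; rewrite !count_cat /resolution /=; case: ifP => _ /=; lia.
have [d1 h1] := ih _ (sr true) (tr true).
have [d2 h2] := ih _ (sr false) (tr false).
exists (A * d1 + A^-1 * d2) => c; apply: SE_trans (SE_kauffman c tw) _.
rewrite mulrDr !mulrA; apply: SE_trans (SE_merge _ _ _ _ _).
exact: (SE_add (h1 _) (h2 _)).
Qed.

Lemma skein_reduce f : comb_in 0 0 f ->
  exists d, skein_eq 0 0 f [:: (d, [::])].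
Proof.
elim: f => [|[c w] f ih] hf; first by exists 0; exact/SE_sym/SE_zero.
have [|d hd] := ih; first by move=> t ht; apply: hf; rewrite inE ht orbT.
have [e he] := skein_reduce_word (hf _ (mem_head _ _)).
exists (c * e + d); apply: SE_trans (SE_merge _ _ _ _ _).
exact: (SE_add (he c) hd).
Qed.

(** A reducing scalar exists, so [xget] does not return its default value. *)
Lemma bracketP f : comb_in 0 0 f -> skein_eq 0 0 f [:: (bracket f, [::])].
Proof.
by move/skein_reduce => [d hd]; exact: (@xgetPex _ 0 [set c : F | _]%classic (ex_intro _ d hd)).
Qed.

(** * Evaluation of projectors and colored diagrams *)

Section EvaluationBracket.
Variable E : skein_model A.

Lemma ev_bracket f : comb_in 0 0 f -> ev E f = bracket f *: 1.
Proof. by move/bracketP/(ev_skein_eq E) ->; rewrite ev1. Qed.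

Lemma ev_tl_nonunital m f : tl_nonunital m f -> tl_ideal m (ev E f).
Proof.
elim=> {f} [i h||f g _ hf _ hg|c f _ hf|f g _ hf _ hg|f g _ fg _ hf].
- by rewrite ev_comb_of /= mulr1; exact: TLI_gen.
- exact: TLI_zero.
- by rewrite ev_cat; exact: TLI_add.
- by rewrite ev_scale; exact: TLI_scale.
- by rewrite ev_stack; exact: TLI_mul.
- by rewrite -(ev_skein_eq E fg).
Qed.

Lemma jones_wenzlP m :
  jones_wenzl m = [::] \/ is_jones_wenzl m (jones_wenzl m).
Proof. by rewrite /jones_wenzl; case: xgetP => [f _|_]; [right|left]. Qed.

Lemma comb_in_jones_wenzl m : comb_in m m (jones_wenzl m).
Proof. by case: (jones_wenzlP m) => [->|[]]. Qed.

Lemma jw_like_jones_wenzl m : jw_like m (ev E (jones_wenzl m)).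
Proof.
case: (jones_wenzlP m) => [->|[_ h1 h2 _ _]].
  by split=> [|i _|i _]; rewrite ?mulr0 ?mul0r //; left.
split.
- right; exists (ev E (jones_wenzl m) - 1); last by rewrite addrC subrK.
  have := ev_tl_nonunital h2.
  by rewrite ev_cat ev_scale ev_comb_of scaleN1r.
- move=> i /h1[_ /(ev_skein_eq E)].
  by rewrite ev_stack ev_comb_of /= mulr1.
- move=> i /h1[/(ev_skein_eq E) + _].
  by rewrite ev_stack ev_comb_of /= mulr1.
Qed.

Lemma ev_cups n i : ev_word E (cups n i) = sh i (cups_el E n).
Proof.
elim: n => [|n ih]; first by rewrite sh1.
by rewrite cups_rcons -cats1 ev_word_cat ih /= mulr1 shM sh_cup.
Qed.
Lemma ev_caps n i : ev_word E (caps n i) = sh i (caps_el E n).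
Proof.
elim: n => [|n ih]; first by rewrite sh1.
by rewrite caps_cons ev_word_cons ih shM sh_cap.
Qed.
Lemma ev_grid b i p q :
  ev_word E [seq (Cross b, (i + j + k)%N) | j <- iota 0 q, k <- rev (iota 0 p)] =
  grid E b i p q.
Proof.
elim: q => [|q ih] //; rewrite iota_rcons allpairs_rcons ev_word_cat ih.
rewrite [grid _ _ _ _ q.+1]/=; congr (_ * _); elim: p {ih} => [|p ih] //.
by rewrite iota_rcons rev_rcons map_cons ev_word_cons ih.
Qed.

Lemma ev_cable m x : ev_word E (cable_letter m x) = cabled E m x.
Proof.
case: x => -[||b] i; rewrite /cable_letter /cabled /=.
- exact: ev_cups.
- exact: ev_caps.
- by rewrite ev_grid sh_grid addn0.
Qed.

Lemma ev_colored_from m f l w :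
  ev E (colored_from m f l w) = colored_el m (ev E f) l w.
Proof.
elim: w l => [|x w ih] l; first exact: ev_comb_of.
rewrite [LHS]ev_stack ev_stack ev_comb_of ev_cable ih; congr (_ * _).
by case: ifP => _; rewrite ?ev_shift ?ev_comb_of.
Qed.

Lemma otarget_forget (w : oword) s s' :
  otarget w s = Some s' -> target (forget w) (size s) = Some (size s').
Proof.
elim: w s => [|[p i] w ih] s /=; first by case=> ->.
case e: orient_step => [s1|] //= /ih; suff [-> ->] :
  (i + arity_in (forget_piece p) <= size s)%N /\
  size s1 = (size s - arity_in (forget_piece p) + arity_out (forget_piece p))%N by [].
case: p e => [o||b]; rewrite /orient_step /=; case: ifP => // h [<-];
  rewrite !size_cat /= size_takel ?size_drop; lia.
Qed.

Lemma ev_colored m (D : diagram) :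
  ev E (colored m D) = decorate m (ev E (jones_wenzl m)) (forget D).
Proof.
have h := otarget_forget (diagramP D).
have jwP := jw_like_jones_wenzl m.
have lx : labelled m (ev E (jones_wenzl m)) 1 [::] by [].
have pl : paired [::] by [].
have e := colored_el_decorate jwP lx pl h.
by rewrite [LHS]ev_colored_from -[LHS]mul1r -e /= !mul1r.
Qed.

End EvaluationBracket.

(** * The writhe under the moves *)

Definition sign_sum (l : seq bool) : int := (count id l)%:Z - (count negb l)%:Z.

Lemma sign_sum_cat l l' : sign_sum (l ++ l') = sign_sum l + sign_sum l'.
Proof. by rewrite /sign_sum !count_cat; lia. Qed.
Lemma sign_sumC l l' : sign_sum (l ++ l') = sign_sum (l' ++ l).
Proof. by rewrite !sign_sum_cat addrC. Qed.

Lemma signs_from_cat (w w' : oword) s s' : otarget w s = Some s' ->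
  signs_from s (w ++ w') = signs_from s w ++ signs_from s' w'.
Proof.
elim: w s => [|x w ih] s /=; first by case=> ->.
case e: orient_step => [s1|] //= /ih ->.
by case: x.1.
Qed.

Definition oshift (k : nat) (w : oword) : oword := [seq (x.1, (x.2 + k)%N) | x <- w].

Lemma take_addn (T : Type) (s s' : seq T) k : take (k + size s) (s ++ s') = s ++ take k s'.
Proof. by rewrite addnC; elim: s => //= x s ->. Qed.
Lemma drop_addn (T : Type) (s s' : seq T) k : drop (k + size s) (s ++ s') = drop k s'.
Proof. by rewrite addnC; elim: s => //= x s ->. Qed.
Lemma nth_addn (T : Type) (z : T) (s s' : seq T) k :
  nth z (s ++ s') (k + size s) = nth z s' k.
Proof. by rewrite addnC; elim: s => //= x s ->. Qed.

Lemma orient_step_cat p k s s' : orient_step (p, (k + size s)%N) (s ++ s') =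
  omap (cat s) (orient_step (p, k) s').
Proof.
rewrite /orient_step /=; case: p => [o||b];
  rewrite -?addSn ?take_addn ?drop_addn ?nth_addn size_cat (addnC (size s)) leq_add2r;
  by case: ifP => //= _; rewrite ?catA.
Qed.

Lemma otarget_shift w s s' :
  otarget (oshift (size s) w) (s ++ s') = omap (cat s) (otarget w s').
Proof.
elim: w s' => //= -[p i] w ih s'; rewrite orient_step_cat.
by case: orient_step => //= s1; exact: ih.
Qed.

Lemma signs_from_shift w s s' t : otarget w s' = Some t ->
  signs_from (s ++ s') (oshift (size s) w) = signs_from s' w.
Proof.
elim: w s' => //= -[p i] w ih s'; rewrite orient_step_cat.
by case: orient_step => //= s1 /ih ->; case: p => // b; rewrite -addSn !nth_addn.
Qed.

Lemma orient_step_size p i s t : orient_step (p, i) s = Some t -> (i <= size s)%N.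
Proof.
rewrite /orient_step /=; case: p => [o||b]; case: ifP => //; lia.
Qed.

(** Strands to the left of a move do not affect its signs. This reduces each move to index 0, where
    finitely many orientations have to be tried. *)
Lemma sign_sum_local (d : int) i u v s t :
  (forall s0 t0, otarget u s0 = Some t0 -> otarget v s0 = Some t0 ->
    sign_sum (signs_from s0 u) = sign_sum (signs_from s0 v) + d) ->
  (i <= size s)%N -> otarget (oshift i u) s = Some t -> otarget (oshift i v) s = Some t ->
  sign_sum (signs_from s (oshift i u)) = sign_sum (signs_from s (oshift i v)) + d.
Proof.
move=> h le_is.
have [s1 [s2 [-> ->]]] : exists s1 s2, s = s1 ++ s2 /\ i = size s1.
  by exists (take i s), (drop i s); rewrite cat_take_drop size_takel.
rewrite !otarget_shift.
case eu: (otarget u _) => [t1|] //= [<-]; case ev: (otarget v _) => [t2|] //= [/eqP].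
rewrite eqseq_cat // eqxx => /eqP e; rewrite -e in eu.
rewrite (signs_from_shift _ eu) (signs_from_shift _ ev); exact: h eu ev.
Qed.

Lemma orient_step0 p s s1 : orient_step (p, 0%N) s = Some s1 ->
  exists r r1 s0, [/\ s = r ++ s0, s1 = r1 ++ s0,
    size r = arity_in (forget_piece p) & size r1 = arity_out (forget_piece p)].
Proof.
rewrite /orient_step /=; case: p => [o||b].
- by case=> <-; exists [::], [:: o; ~~ o], s; rewrite take0 drop0.
- case: s => [|x [|y s]] //=; case: ifP => // _ [<-].
  by exists [:: x; y], [::], s; rewrite ?drop0.
- case: s => [|x [|y s]] //= [<-].
  by exists [:: x; y], [:: y; x], s; rewrite ?drop0.
Qed.

Lemma signs_from1_cat q k s s' :
  signs_from (s ++ s') [:: (q, (k + size s)%N)] = signs_from s' [:: (q, k)].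
Proof. by rewrite /=; case: q => // b; rewrite -addSn !nth_addn. Qed.

Lemma signs_from_cat1 q s (w : oword) s1 : orient_step q s = Some s1 ->
  signs_from s (q :: w) = signs_from s [:: q] ++ signs_from s1 w.
Proof. by move=> /= ->; case: q.1. Qed.

Lemma signs_from1 p p' i s : forget_piece p = forget_piece p' ->
  signs_from s [:: (p, i)] = signs_from s [:: (p', i)].
Proof. by case: p p' => [o||b] [o'||b'] //= [->]. Qed.

(** Each letter meets the same oriented strands in both words, so the two lists of signs differ only
    in their order. *)
Lemma sign_sum_exchange p q p' q' k s t t' :
  forget_piece p = forget_piece p' -> forget_piece q = forget_piece q' ->
  otarget [:: (p, 0%N); (q, (k + arity_out (forget_piece p))%N)] s = Some t ->
  otarget [:: (q', (k + arity_in (forget_piece p))%N); (p', 0%N)] s = Some t' ->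
  sign_sum (signs_from s [:: (p, 0%N); (q, (k + arity_out (forget_piece p))%N)]) =
  sign_sum (signs_from s [:: (q', (k + arity_in (forget_piece p))%N); (p', 0%N)]).
Proof.
move=> ep eq hu hv.
case e1: (orient_step (p, 0%N) s) hu => [s1|]; last by rewrite /= e1.
case e2: (orient_step (q', (k + arity_in (forget_piece p))%N) s) hv => [s2|]; last by rewrite /= e2.
move=> _ _; rewrite (signs_from_cat1 _ e1) (signs_from_cat1 _ e2) [RHS]sign_sumC.
have [r [r1 [s0 [es es1 sr sr1]]]] := orient_step0 e1.
congr sign_sum; congr (_ ++ _); last first.
  by rewrite es es1 -{1}sr1 -sr !signs_from1_cat; exact: signs_from1.
rewrite (signs_from1 _ _ ep); subst s; rewrite -sr orient_step_cat in e2.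
case: (orient_step _ s0) e2 => //= s3 [<-].
case: (p') ep => [o||b] ep; rewrite ep in sr => //.
by case: r sr {e1} => [|x [|y []]].
Qed.

Lemma otarget_cons_size p i (w : oword) s t :
  otarget ((p, i) :: w) s = Some t -> (i <= size s)%N.
Proof. by rewrite /=; case e: orient_step => [s1|] // _; exact: orient_step_size e. Qed.

(* For a claim on an explicit word with indices 0 and 1: enumerates the
   orientations of the first three strands. *)
Ltac orient s :=
  case: s => [|? [|? [|? s]]]; rewrite /= ?take0 ?drop0 //=;
  repeat match goal with x : bool |- _ => destruct x end; simpl;
  intros; first [reflexivity | congruence].

Lemma forget_nil u : forget u = [::] -> u = [::].
Proof. by case: u. Qed.
Lemma forget_consI p i w u : forget u = (p, i) :: w ->
  exists p' u', [/\ u = (p', i) :: u', forget_piece p' = p & forget u' = w].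
Proof. by case: u => // -[p' j] u' /= [<- -> <-]; exists p', u'. Qed.
Lemma forget_piece_cup p : forget_piece p = Cup -> exists o, p = OCup o.
Proof. by case: p => // o _; exists o. Qed.
Lemma forget_piece_cap p : forget_piece p = Cap -> p = OCap.
Proof. by case: p. Qed.
Lemma forget_piece_cross p b : forget_piece p = Cross b -> p = OCross b.
Proof. by case: p => // c [->]. Qed.

Ltac forget_inv e := match type of e with
  | forget ?u = [::] => move/forget_nil: e => ?; subst u
  | forget ?u = _ :: _ =>
      let p := fresh "p" in let u' := fresh "u" in
      let e1 := fresh "e" in let e2 := fresh "e" in
      case/forget_consI: e => p [u' [? e1 e2]]; subst u;
      first [ case/forget_piece_cup: e1 => ? ?; subst p
            | move/forget_piece_cap: e1 => ?; subst p
            | move/forget_piece_cross: e1 => ?; subst p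
            | idtac ];
      forget_inv e2
  end.

Lemma sign_sum_planar (u v : oword) s t :
  planar_move (forget u) (forget v) ->
  otarget u s = Some t -> otarget v s = Some t ->
  sign_sum (signs_from s u) = sign_sum (signs_from s v).
Proof.
move eu: (forget u) => u'; move ev: (forget v) => v' mv hu hv.
rewrite -[sign_sum (signs_from s v)]addr0.
case: mv eu ev => [p q i k|i|i|b i|b i] eu ev; [|forget_inv eu; forget_inv ev..].
- case/forget_consI: eu hu => p1 [u1 [-> ep /forget_consI[q1 [u2 [-> eq /forget_nil ->]]]]] hu.
  case/forget_consI: ev hv => q2 [u3 [-> eq2 /forget_consI[p2 [u4 [-> ep2 /forget_nil ->]]]]] hv.
  have le_is := otarget_cons_size hu; move: hu hv.
  rewrite -!addnA !(addnC i) -ep -!(addnC k) => hu hv.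
  apply: (@sign_sum_local 0 i
    [:: (p1, 0%N); (q1, (k + arity_out (forget_piece p1))%N)]
    [:: (q2, (k + arity_in (forget_piece p1))%N); (p2, 0%N)]) hu hv => // s0 t0.
  rewrite addr0; apply: sign_sum_exchange; congruence.
- by rewrite addr0; move: hu => /=; case: orient_step.
- by rewrite addr0; move: hu => /=; case: orient_step.
- have le_is := otarget_cons_size hu.
  apply: (@sign_sum_local 0 i [:: (OCup _, 0%N); (OCross b, 1%N)]
    [:: (OCup _, 1%N); (OCross (~~ b), 0%N)]) hu hv => // s0 t0.
  by orient s0.
- have le_is := otarget_cons_size hu.
  apply: (@sign_sum_local 0 i [:: (OCross b, 0%N); (OCap, 1%N)]
    [:: (OCross (~~ b), 1%N); (OCap, 0%N)]) hu hv => // s0 t0.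
  by orient s0.
Qed.

Lemma sign_sum_rm2 (u v : oword) b i s t :
  forget u = [:: (Cross b, i); (Cross (~~ b), i)] -> forget v = [::] ->
  otarget u s = Some t -> otarget v s = Some t ->
  sign_sum (signs_from s u) = sign_sum (signs_from s v).
Proof.
move=> eu ev hu hv; rewrite -[RHS]addr0; forget_inv eu; forget_inv ev.
have le_is := otarget_cons_size hu.
apply: (@sign_sum_local 0 i [:: (OCross b, 0%N); (OCross (~~ b), 0%N)] [::])
  hu hv => // s0 t0.
by orient s0.
Qed.

Lemma sign_sum_rm3 (u v : oword) b b' b'' i s t :
  forget u = [:: (Cross b, i); (Cross b', i.+1); (Cross b'', i)] ->
  forget v = [:: (Cross b'', i.+1); (Cross b', i); (Cross b, i.+1)] ->
  otarget u s = Some t -> otarget v s = Some t ->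
  sign_sum (signs_from s u) = sign_sum (signs_from s v).
Proof.
move=> eu ev hu hv; rewrite -[RHS]addr0; forget_inv eu; forget_inv ev.
have le_is := otarget_cons_size hu.
apply: (@sign_sum_local 0 i
    [:: (OCross b, 0%N); (OCross b', 1%N); (OCross b'', 0%N)]
    [:: (OCross b'', 1%N); (OCross b', 0%N); (OCross b, 1%N)])
  hu hv => // s0 t0.
by orient s0.
Qed.

(** Reversing a strand reverses both of its passages through the crossing of a curl, so the sign
    depends on the kind of crossing only. *)
Definition curl_writhe (b : bool) : int := if b then 1 else -1.

Lemma sign_sum_rm1_right (u v : oword) b i s t :
  forget u = [:: (Cup, i.+1); (Cross b, i); (Cap, i.+1)] -> forget v = [::] ->
  otarget u s = Some t -> otarget v s = Some t ->
  sign_sum (signs_from s u) = sign_sum (signs_from s v) + curl_writhe b.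
Proof.
move=> eu ev hu hv; forget_inv eu; forget_inv ev.
have le_is := ltnW (otarget_cons_size hu).
apply: (@sign_sum_local _ i [:: (OCup _, 1%N); (OCross b, 0%N); (OCap, 1%N)] [::])
  hu hv => // s0 t0.
by orient s0.
Qed.

Lemma sign_sum_rm1_left (u v : oword) b i s t :
  forget u = [:: (Cup, i); (Cross b, i.+1); (Cap, i)] -> forget v = [::] ->
  otarget u s = Some t -> otarget v s = Some t ->
  sign_sum (signs_from s u) = sign_sum (signs_from s v) + curl_writhe b.
Proof.
move=> eu ev hu hv; forget_inv eu; forget_inv ev.
have le_is := otarget_cons_size hu.
apply: (@sign_sum_local _ i [:: (OCup _, 0%N); (OCross b, 1%N); (OCap, 0%N)] [::])
  hu hv => // s0 t0.
by orient s0.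
Qed.

Lemma writhe_move (x u v y : oword) (D D' : diagram) s t d :
  diagram_word D = x ++ u ++ y -> diagram_word D' = x ++ v ++ y ->
  otarget x [::] = Some s -> otarget u s = Some t -> otarget v s = Some t ->
  sign_sum (signs_from s u) = sign_sum (signs_from s v) + d ->
  writhe D = writhe D' + d.
Proof.
move=> eD eD' hx hu hv h.
have wE (D0 : diagram) : writhe D0 = sign_sum (signs_from [::] D0) by [].
rewrite !wE eD eD' !(signs_from_cat _ hx) (signs_from_cat _ hu) (signs_from_cat _ hv).
by rewrite !sign_sum_cat h; ring.
Qed.

(** * From decorated words to brackets, and the framing factor *)

Section Invariance.
Variable E : skein_model A.
Variable m : nat.
Let P := ev E (jones_wenzl m).

Lemma decorate_move (x u v y : oword) s t (c : F) :
  otarget x [::] = Some s -> otarget u s = Some t ->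
  (forall z n, absorbs m P n z -> (n = size s)%N ->
    z * decorate m P (forget u) = c *: (z * decorate m P (forget v))) ->
  decorate m P (forget (x ++ u ++ y)) = c *: decorate m P (forget (x ++ v ++ y)).
Proof.
move=> hx hu h; have jwP := jw_like_jones_wenzl E m.
rewrite /forget !map_cat !decorate_cat !mulrA scalerAl; congr (_ * _).
apply: h (erefl _); rewrite -[decorate _ _ _]mul1r.
by apply: absorbs_decorate (otarget_forget hx) _ => // j.
Qed.

Lemma bracket_colored (D D' : diagram) c :
  decorate m P (forget D) = c *: decorate m P (forget D') ->
  bracket (colored m D) = c * bracket (colored m D').
Proof.
have colP (D0 : diagram) : comb_in 0 0 (colored m D0).
  have := comb_in_colored (l := [::]) (@comb_in_jones_wenzl m) (otarget_forget (diagramP D0)).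
  by rewrite !muln0.
rewrite -!ev_colored !ev_bracket // scalerA => /eqP.
(* Equal multiples of [1] have equal coefficients since [1 != 0] in the algebra. *)
rewrite -subr_eq0 -scalerBl scaler_eq0 oner_eq0 orbF subr_eq0.
by move/eqP.
Qed.

Definition framing : F := (-1) ^+ m * q4 ^+ (m ^ 2 + 2 * m).

Lemma q4_neq0 : q4 != 0.
Proof. by rewrite /q4 tofrac_eq0 polyX_eq0. Qed.

Lemma framing_neq0 : framing != 0.
Proof. by rewrite mulf_neq0 // ?signr_eq0 // expf_neq0 // q4_neq0. Qed.

(** Here [A = q4^-1] enters. The curl moves produce the twist of [~~ b], hence the inverse of the
    change in the writhe factor. *)
Lemma twist_framing b : twist A b m = framing ^ curl_writhe b.
Proof.
rewrite /twist /framing /curl_writhe /coef /A; case: b.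
  by rewrite exprVn invrK expr1z.
by rewrite invrK exprN1 invfM -signr_odd; case: odd; rewrite ?expr1 ?invrN ?invr1.
Qed.

End Invariance.

(** * A model by operators *)

(* A state assigns a scalar to each labelling of infinitely many strands by
   bits, so that words with any number of strands act on the same space. *)
Section OperatorModel.
Variable (K : fieldType).

Definition state : Type := (nat -> bool) -> K.

Definition lin_op (f : state -> state) : Prop :=
  (forall p q : state, f (fun s => p s + q s) = fun s => f p s + f q s) /\
  (forall (c : K) (p : state), f (fun s => c * p s) = fun s => c * f p s).

(** Linearity is what makes composition distribute over sums in its second argument. *)
Record operator := Operator { op_fun :> state -> state; op_lin : lin_op op_fun }.

Lemma opD (f : operator) (p q : state) s : f (fun s => p s + q s) s = f p s + f q s.
Proof. by rewrite (op_lin f).1. Qed.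
Lemma opZ (f : operator) c (p : state) s : f (fun s => c * p s) s = c * f p s.
Proof. by rewrite (op_lin f).2. Qed.

Lemma operatorP (f g : operator) : (forall p s, f p s = g p s) -> f = g.
Proof.
move=> h; have e : op_fun f = op_fun g by apply/funext => p; apply/funext => s.
case: f g e {h} => [f hf] [g hg] /= e; subst g.
by congr Operator; exact: Prop_irrelevance.
Qed.

HB.instance Definition _ := gen_eqMixin operator.
HB.instance Definition _ := gen_choiceMixin operator.

Lemma op_zero_lin : lin_op (fun _ _ => 0).
Proof. by split=> *; apply/funext => s; rewrite ?addr0 ?mulr0. Qed.
Definition op_zero := Operator op_zero_lin.

Lemma op_one_lin : lin_op id.
Proof. by []. Qed.
Definition op_one := Operator op_one_lin.

Lemma op_opp_lin (f : operator) : lin_op (fun p s => - f p s).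
Proof. by split=> *; apply/funext => s; rewrite ?opD ?opZ ?opprD ?mulrN. Qed.
Definition op_opp f := Operator (op_opp_lin f).

Lemma op_add_lin (f g : operator) : lin_op (fun p s => f p s + g p s).
Proof. by split=> *; apply/funext => s; rewrite ?opD ?opZ ?mulrDr // addrACA. Qed.
Definition op_add f g := Operator (op_add_lin f g).

Lemma op_mul_lin (f g : operator) : lin_op (f \o g).
Proof.
split=> [p q|c p]; rewrite /=; first by rewrite (op_lin g).1 (op_lin f).1.
by rewrite (op_lin g).2 (op_lin f).2.
Qed.
(** A state is a function of the labels above a word, and its image a function of the labels below;
    hence the upper factor, on the right, acts first. *)
Definition op_mul f g := Operator (op_mul_lin f g).

Lemma op_scale_lin c (f : operator) : lin_op (fun p s => c * f p s).
Proof. by split=> *; apply/funext => s; rewrite ?opD ?opZ ?mulrDr // mulrCA. Qed.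
Definition op_scale c f := Operator (op_scale_lin c f).

Lemma op_addA : associative op_add.
Proof. by move=> f g h; apply: operatorP => p s; exact: addrA. Qed.
Lemma op_addC : commutative op_add.
Proof. by move=> f g; apply: operatorP => p s; exact: addrC. Qed.
Lemma op_add0 : left_id op_zero op_add.
Proof. by move=> f; apply: operatorP => p s; exact: add0r. Qed.
Lemma op_addN : left_inverse op_zero op_opp op_add.
Proof. by move=> f; apply: operatorP => p s; exact: addNr. Qed.
HB.instance Definition _ :=
  GRing.isZmodule.Build operator op_addA op_addC op_add0 op_addN.

Lemma op_mulA : associative op_mul.
Proof. by move=> f g h; exact: operatorP. Qed.
Lemma op_mul1 : left_id op_one op_mul.
Proof. by move=> f; exact: operatorP. Qed.
Lemma op_1mul : right_id op_one op_mul.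
Proof. by move=> f; exact: operatorP. Qed.
Lemma op_mulDl : left_distributive op_mul +%R.
Proof. by move=> f g h; exact: operatorP. Qed.
Lemma op_mulDr : right_distributive op_mul +%R.
Proof. by move=> f g h; apply: operatorP => p s; exact: opD. Qed.
Lemma op_one_neq0 : op_one != 0.
Proof.
apply/eqP => /(congr1 (fun f : operator => f (fun _ => 1) (fun _ => true))) /eqP.
by rewrite /= oner_eq0.
Qed.
HB.instance Definition _ := GRing.Zmodule_isNzRing.Build operator
  op_mulA op_mul1 op_1mul op_mulDl op_mulDr op_one_neq0.

Lemma op_scaleA c d f : op_scale c (op_scale d f) = op_scale (c * d) f.
Proof. by apply: operatorP => p s; exact: mulrA. Qed.
Lemma op_scale1 : left_id 1 op_scale.
Proof. by move=> f; apply: operatorP => p s; exact: mul1r. Qed.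
Lemma op_scaleDr : right_distributive op_scale +%R.
Proof. by move=> c f g; apply: operatorP => p s; exact: mulrDr. Qed.
Lemma op_scaleDl f : {morph op_scale^~ f : c d / c + d}.
Proof. by move=> c d; apply: operatorP => p s; exact: mulrDl. Qed.
HB.instance Definition _ := GRing.Zmodule_isLmodule.Build K operator
  op_scaleA op_scale1 op_scaleDr op_scaleDl.

Lemma op_scaleAl (c : K) (f g : operator) : c *: (f * g) = (c *: f) * g.
Proof. exact: operatorP. Qed.
HB.instance Definition _ := GRing.Lmodule_isLalgebra.Build K operator op_scaleAl.

Lemma op_scaleAr (c : K) (f g : operator) : c *: (f * g) = f * (c *: g).
Proof. by apply: operatorP => p s; rewrite -[RHS]/(f (fun s => c * g p s) s) opZ. Qed.
HB.instance Definition _ := GRing.Lalgebra_isAlgebra.Build K operator op_scaleAr.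

Definition scons (x : bool) (s : nat -> bool) : nat -> bool :=
  fun n => if n is n'.+1 then s n' else x.
Definition stail (s : nat -> bool) : nat -> bool := fun n => s n.+1.

Lemma sconsK s : scons (s 0%N) (stail s) = s.
Proof. by apply/funext => -[]. Qed.

Lemma op_shift_lin (f : operator) :
  lin_op (fun p s => f (fun s' => p (scons (s 0%N) s')) (stail s)).
Proof. by split=> *; apply/funext => s; rewrite ?opD ?opZ. Qed.
(** Tensor product with the identity of a new leftmost strand. *)
Definition op_shift f : operator := Operator (op_shift_lin f).

Lemma op_shift_zmod : zmod_morphism op_shift.
Proof. by move=> f g; exact: operatorP. Qed.
Lemma op_shift_monoid : monoid_morphism op_shift.
Proof.
split; last by move=> f g; exact: operatorP.
by apply: operatorP => p s /=; rewrite sconsK.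
Qed.
Lemma op_shift_scalable : scalable op_shift.
Proof. by move=> c f; exact: operatorP. Qed.
HB.instance Definition _ := GRing.isZmodMorphism.Build _ _ op_shift op_shift_zmod.
HB.instance Definition _ := GRing.isMonoidMorphism.Build _ _ op_shift op_shift_monoid.
HB.instance Definition _ := GRing.isScalable.Build K _ _ *:%R op_shift op_shift_scalable.

Variable (a : K) (a_neq0 : a != 0).

(* The pairing with matrix [[0, 1], [- a^-2, 0]] and its inverse. *)
Definition pairing (x y : bool) : K :=
  if x == y then 0 else if x then - a ^- 2 else 1.

Lemma op_cap_lin : lin_op (fun p s => pairing (s 0%N) (s 1%N) * p (stail (stail s))).
Proof. by split=> *; apply/funext => s; rewrite ?mulrDr // mulrCA. Qed.
Definition op_cap : operator := Operator op_cap_lin.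

Lemma op_cup_lin : lin_op (fun p s =>
  - a ^+ 2 * p (scons false (scons true s)) + p (scons true (scons false s))).
Proof.
split=> *; apply/funext => s; first by rewrite mulrDr addrACA.
by rewrite mulrDr mulrCA.
Qed.
Definition op_cup : operator := Operator op_cup_lin.

Definition operator_model : skein_model a.
Proof.
apply: (@SkeinModel K a operator a_neq0 op_shift op_cup op_cap).
- move=> f; apply: operatorP => p s /=.
  by rewrite opD opZ.
- move=> f; apply: operatorP => p s /=.
  by rewrite opZ.
- apply: operatorP => p s; rewrite -[RHS]/(p s) -{2}(sconsK s) /= /pairing /stail /scons /=.
  by case: (s 0%N); rewrite /= ?mul0r ?mulr0 ?add0r ?addr0 ?mul1r // mulrA mulrNN
    mulfV ?mul1r // expf_neq0.
- apply: operatorP => p s; rewrite -[RHS]/(p s) -{2}(sconsK s) /= /pairing /stail /scons /=.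
  by case: (s 0%N); rewrite /= ?mul0r ?mulr0 ?add0r ?addr0 ?mul1r // mulrA mulrNN
    mulfV ?mul1r // expf_neq0.
- apply: operatorP => p s; rewrite -[RHS]/((- a ^+ 2 - a ^- 2) * p s) /= /pairing /stail /scons /=.
  by rewrite mul1r -mulrDl.
Defined.

End OperatorModel.

(** * Invariance of the colored Jones polynomial, and conclusion *)

Definition model : skein_model A := operator_model (invr_neq0 q4_neq0).

Lemma colored_jones_framing n (D D' : diagram) (d : int) :
  writhe D = writhe D' + d ->
  bracket (colored n.-1 D) = framing n.-1 ^ (- d) * bracket (colored n.-1 D') ->
  colored_jones n D = colored_jones n D'.
Proof.
move=> ew eb; rewrite /colored_jones ew eb -/(framing n.-1).
have f0 := framing_neq0 n.-1.
by rewrite expfzDr // !mulrA -(mulrA (_ ^ _)) -expfzDr // subrr mulr1.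
Qed.

Lemma colored_jones_move n (D D' : diagram) :
  diagram_move D D' -> colored_jones n D = colored_jones n D'.
Proof.
move=> [x [u [v [y [s [t [eD eD' hx [hu hv] mv]]]]]]].
set m := n.-1; pose P := ev model (jones_wenzl m).
have jwP : jw_like m P := jw_like_jones_wenzl model m.
have tu := otarget_forget hu.
(* All moves take one form: the writhe changes by [d] and the decorated word by [framing m ^ (- d)],
   with [d = 0] except for curls. *)
suff [d [ew ed]] : exists d : int,
    sign_sum (signs_from s u) = sign_sum (signs_from s v) + d /\
    forall z, absorbs m P (size s) z -> z * decorate m P (forget u) =
      framing m ^ (- d) *: (z * decorate m P (forget v)).
  apply: (colored_jones_framing (writhe_move eD eD' hx hu hv ew)).
  apply: (bracket_colored (E := model)); rewrite -/P eD eD'.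
  by apply: decorate_move hx hu _ => z k hz ek; apply: ed; rewrite -ek.
case: mv => [mv|].
  exists 0; rewrite oppr0 expr0z addr0; split.
    exact: sign_sum_planar mv hu hv.
  by move=> z hz; rewrite scale1r (decorate_planar jwP mv tu hz).
move eu: (forget u) => u'; move ev: (forget v) => v' mv.
have curlN b : curl_writhe (~~ b) = - curl_writhe b by case: b.
rewrite eu in tu; case: mv eu ev tu => [b i|b i|b i|b b' b'' i hb] eu ev tu.
- exists (curl_writhe b); split; first exact: sign_sum_rm1_right eu ev hu hv.
  move=> z hz; rewrite -curlN -twist_framing mulr1.
  apply: (decorate_rm1_right jwP b _ hz).
  by move: tu => /=; case: ifP => // h1 _; lia.
- exists (curl_writhe b); split; first exact: sign_sum_rm1_left eu ev hu hv.
  move=> z hz; rewrite -curlN -twist_framing mulr1.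
  apply: (decorate_rm1_left jwP b _ hz).
  by move: tu => /=; case: ifP => // h1; case: ifP => // h2 _; lia.
- exists 0; rewrite oppr0 expr0z addr0; split.
    exact: sign_sum_rm2 eu ev hu hv.
  by move=> z hz; rewrite scale1r (decorate_rm2 _ _ b i).
- exists 0; rewrite oppr0 expr0z addr0; split.
    exact: sign_sum_rm3 eu ev hu hv.
  by move=> z hz; rewrite scale1r (decorate_rm3 _ _ i hb).
Qed.

Lemma colored_jones_same_link n (D D' : diagram) :
  same_link D D' -> colored_jones n D = colored_jones n D'.
Proof.
by elim=> // [x y /(colored_jones_move n)|x y z _ -> _ ->].
Qed.

(** Two minima of a total order have the same complexity. The writhe is [c - 2 c_-], so the first
    two entries fix it, and the third then fixes the number of state circles. *)
Lemma minimal_complexity (K : oriented_link) (D D' : diagram) :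
  minimal_diagrams K D -> minimal_diagrams K D' ->
  [/\ crossings D = crossings D', splus D = splus D' & writhe D = writhe D'].
Proof.
move=> [KD hD] [KD' hD'].
have e : complexity D = complexity D' by apply/le_anti; rewrite hD ?hD'.
have wE (D0 : diagram) :
    writhe D0 = (crossings D0)%:Z - (neg_crossings D0)%:Z *+ 2.
  rewrite /writhe /crossings /neg_crossings.
  have := count_predC id (signs D0).
  by rewrite (@eq_count _ (predC id) negb) // => <-; lia.
case: e => en ec es.
have ew : writhe D = writhe D' by rewrite !wE en ec.
split=> //; move: es; rewrite ew; lia.
Qed.

Theorem corollary4p4 (K : oriented_link) (D D' : diagram) :
  minimal_diagrams K D -> minimal_diagrams K D' -> Jplus D = Jplus D'.
Proof.
move=> mD mD'; have [ec es ew] := minimal_complexity mD mD'.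
have [D0 hD0] := diagramsP K.
have sl : same_link D D'.
  apply: (rst_trans _ _ _ D0); last exact/hD0/mD'.1.
  by apply: rst_sym; exact/hD0/mD.1.
apply/funext => i; rewrite /Jplus /beta /h ec es ew.
by rewrite (colored_jones_same_link i sl).
Qed.
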